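(* Let $\alpha,\beta,\gamma_1,\gamma_2\in\mathbb R$ be such that $\alpha\beta\ne0$. Let $[a,b]\times[c,d]\subseteq\mathbb R^2$ and let $f\in\mathcal A_c(\mathbb R^2)$. (a) If $\Psi:\mathbb R^2\to\mathbb R^2$ is given by $\Psi(u,v)=(\alpha u+\gamma_1,\beta v+\gamma_2)$ then $$\int_a^b\int_c^df(x,y)\,dy\,dx=\alpha\beta\int_{(a-\gamma_1)/\alpha}^{(b-\gamma_1)/\alpha}\int_{(c-\gamma_2)/\beta}^{(d-\gamma_2)/\beta}f(\alpha u+\gamma_1,\beta v+\gamma_2)\,dv\,du.$$ (b) If $\Psi:\mathbb R^2\to\mathbb R^2$ is given by $\Psi(u,v)=(\beta v+\gamma_2,\alpha u+\gamma_1)$ then $$\int_a^b\int_c^df(x,y)\,dy\,dx=\alpha\beta\int_{(c-\gamma_1)/\alpha}^{(d-\gamma_1)/\alpha}\int_{(a-\gamma_2)/\beta}^{(b-\gamma_2)/\beta}f(\beta v+\gamma_2,\alpha u+\gamma_1)\,dv\,du.$$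
   Context: $\overline{\mathbb R}=[-\infty,\infty]$ is the two-point compactification of $\mathbb R$, and $\overline{\mathbb R}^2$ carries the product topology. $\mathcal B_c(\overline{\mathbb R}^2)$ is the set of continuous $F:\overline{\mathbb R}^2\to\mathbb R$ with $F(-\infty,s)=F(s,-\infty)=0$ for all $s\in\overline{\mathbb R}$. $\partial_{12}=\partial_1\partial_2$ is the distributional derivative on $\mathbb R^2$, and $\mathcal A_c(\mathbb R^2)=\{\partial_{12}F\mid F\in\mathcal B_c(\overline{\mathbb R}^2)\}\subset\mathcal D'(\mathbb R^2)$; the primitive $F$ of $f=\partial_{12}F$ is unique, and $\partial_{12}G\in\mathcal A_c(\mathbb R^2)$ for every continuous $G:\overline{\mathbb R}^2\to\mathbb R$. The continuous primitive integral is $\int_a^b\int_c^df=\int_a^b\int_c^df(x,y)\,dy\,dx=F(a,c)+F(b,d)-F(a,d)-F(b,c)$, with the orientation convention $\int_b^a\int_c^df=-\int_a^b\int_c^df=\int_a^b\int_d^cf$. For an affine bijection $\Psi:\mathbb R^2\to\mathbb R^2$ and a distribution $T\in\mathcal D'(\mathbb R^2)$ the composition $T\circ\Psi\in\mathcal D'(\mathbb R^2)$ is defined by $\langle T\circ\Psi,\phi\rangle=|\det\Psi|^{-1}\langle T,\phi\circ\Psi^{-1}\rangle$ for $\phi\in C_c^\infty(\mathbb R^2)$, where $\det\Psi$ is the determinant of the linear part; $f(\alpha u+\gamma_1,\beta v+\gamma_2)$ and $f(\beta v+\gamma_2,\alpha u+\gamma_1)$ denote the distributions $f\circ\Psi$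 in the variables $(u,v)$. *)

(* Defs.v *)
From HB Require Import structures.
From mathcomp Require Import all_boot all_order all_algebra.
From mathcomp Require Import all_classical all_reals all_analysis.
From mathcomp Require Import measurable_realfun ring.

Set Implicit Arguments.
Unset Strict Implicit.
Unset Printing Implicit Defensive.

Import Order.TTheory GRing.Theory Num.Theory numFieldNormedType.Exports.

Local Open Scope classical_set_scope.
Local Open Scope ring_scope.

Variant axis := axis1 | axis2.

Section smooth.
Context {R : realType}.
Implicit Types (phi psi : R * R -> R) (w : seq axis) (c : R).

Definition unit_vec (i : axis) : R * R :=
  match i with axis1 => (1, 0) | axis2 => (0, 1) end.

Definition partial (i : axis) phi : R * R -> R := 'D_(unit_vec i) phi.

Definition partials w phi : R * R -> R := foldr partial phi w.

(* partials w phi exhausts the iterated partial derivatives; asking for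
   differentiability of all of them, rather than for continuity, is the usual
   notion of C^oo since differentiable functions are continuous and C^1
   functions are differentiable. *)
Definition smooth phi : Prop :=
  forall w p, differentiable (partials w phi) p.

(* The closed support; ssralg's support is the set of nonzeros. *)
Definition tsupport phi : set (R * R) := closure [set p | phi p != 0].

Lemma partials_lin c phi psi w : smooth phi -> smooth psi ->
  partials w (c *: phi + psi) = c *: partials w phi + partials w psi.
Proof.
move=> sphi spsi; elim: w => //= i w ->.
apply/funext => p; rewrite /partial.
rewrite deriveD; [|apply: derivableZ|]; try exact/diff_derivable.
rewrite deriveZ//; exact/diff_derivable.
Qed.

Lemma smooth_lin c phi psi :
  smooth phi -> smooth psi -> smooth (c *: phi + psi).
Proof.
move=> sphi spsi w p; rewrite partials_lin//.
apply: differentiableD; last exact: spsi.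
exact/differentiableZ/sphi.
Qed.

Lemma partials0 w : partials w 0 = 0.
Proof.
elim: w => //= i w ->; apply/funext => p; rewrite /partial.
exact: (derive_cst (0 : R)).
Qed.

Lemma smooth0 : smooth 0.
Proof. by move=> w p; rewrite partials0; exact: (differentiable_cst (0 : R)). Qed.

Lemma partials_cat w1 w2 phi : partials w1 (partials w2 phi) = partials (w1 ++ w2) phi.
Proof. by rewrite /partials foldr_cat. Qed.

Lemma smooth_partial i phi : smooth phi -> smooth (partial i phi).
Proof.
by move=> sphi w p; rewrite -[partial i phi]/(partials [:: i] phi) partials_cat.
Qed.

Lemma tsupport_eq0 phi p : ~ tsupport phi p -> phi p = 0.
Proof. by move=> np; apply: contra_notP np => /eqP h; exact: (@subset_closure _ [set p | phi p != 0]). Qed.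

Lemma tsupport_near0 phi p : ~ tsupport phi p -> \forall q \near p, phi q = 0.
Proof.
move=> np; have : nbhs p (~` tsupport phi).
  by apply: open_nbhs_nbhs; split=> //; exact/closed_openC/closed_closure.
by apply: filterS => q /tsupport_eq0.
Qed.

Lemma tsupport_partial i phi : tsupport (partial i phi) `<=` tsupport phi.
Proof.
have /closure_id -> : closed (tsupport phi) by exact: closed_closure.
apply: closure_subset => p /eqP/= dp; apply: contrapT => /tsupport_near0 np.
by apply: dp; rewrite /partial (near_eq_derive _ np) (derive_cst (0 : R)).
Qed.

Lemma tsupport_partials w phi : tsupport (partials w phi) `<=` tsupport phi.
Proof.
elim: w => //= i w; apply: subset_trans; exact: tsupport_partial.
Qed.

Lemma tsupport_lin c phi psi :
  tsupport (c *: phi + psi) `<=` tsupport phi `|` tsupport psi.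
Proof.
rewrite /tsupport -closureU; apply: closure_subset => p /= h.
have [phi0|?] := eqVneq (phi p) 0; last by left.
right; apply: contra_neq h => psi0.
by rewrite /= !fctE phi0 psi0 scaler0 addr0.
Qed.

Lemma tsupport0 : tsupport 0 = set0.
Proof.
rewrite /tsupport (_ : [set _ | _] = set0) ?closure0//.
by apply/seteqP; split => // p /=; rewrite eqxx.
Qed.

Lemma subtsupport_compact (K : set (R * R)) phi :
  compact K -> tsupport phi `<=` K -> compact (tsupport phi).
Proof. by move=> cK; apply: subclosed_compact => //; exact: closed_closure. Qed.

Definition test_function : {pred R * R -> R} :=
  mem [set phi | smooth phi /\ compact (tsupport phi)].

Lemma test_functionP phi :
  reflect (smooth phi /\ compact (tsupport phi)) (phi \in test_function).
Proof. by apply: (iffP idP); rewrite inE. Qed.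

Lemma test_function_submod_closed : submod_closed test_function.
Proof.
split=> [|c phi psi].
  by apply/test_functionP; rewrite tsupport0; split; [exact: smooth0|exact: compact0].
move=> /test_functionP[sphi cphi] /test_functionP[spsi cpsi].
apply/test_functionP; split; first exact: smooth_lin.
apply: (@subtsupport_compact (tsupport phi `|` tsupport psi)); last exact: tsupport_lin.
exact: compactU.
Qed.

HB.instance Definition _ :=
  GRing.isSubmodClosed.Build R (R * R -> R) test_function
    test_function_submod_closed.

End smooth.

Record testfun (R : realType) := TestFun {
  testfun_fun :> R * R -> R;
  testfun_in : testfun_fun \in @test_function R }.

Section testfun_lmod.
Context {R : realType}.
HB.instance Definition _ := [isSub of testfun R for @testfun_fun R].
HB.instance Definition _ := [Choice of testfun R by <:].
HB.instance Definition _ := [SubChoice_isSubLmodule of testfun R by <:].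
End testfun_lmod.

Section plane_integral.
Context {R : realType}.
Implicit Types (f g : R * R -> R).

Definition plane_measure : {measure set (measurableTypeR R * measurableTypeR R) -> \bar R} :=
  (@lebesgue_measure R \x @lebesgue_measure R)%E.

Lemma open_measurable_plane (U : set (R * R)) : open U ->
  measurable (U : set (measurableTypeR R * measurableTypeR R)).
Proof.
move=> oU.
pose box (k : rat * rat * nat) : set (measurableTypeR R * measurableTypeR R) :=
  ball (ratr k.1.1 : R) (k.2.+1%:R^-1) `*` ball (ratr k.1.2 : R) (k.2.+1%:R^-1).
have -> : U = \bigcup_(k in [set k | box k `<=` U]) box k.
  apply/seteqP; split=> [[x y] Uxy|p [k] /= + bk]; last exact.
  move: oU; rewrite openE => /(_ _ Uxy)/nbhs_ballP[e /= e0 eU].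
  have [n ne] : exists n, n.+1%:R^-1 < e / 2.
    exists (Num.truncn (e / 2)^-1).
    by rewrite invf_plt ?posrE ?divr_gt0// truncnS_gt.
  have n0 : (0 : R) < n.+1%:R^-1 by rewrite invr_gt0.
  have near_rat (z : R) : exists q : rat, ball (ratr q : R) n.+1%:R^-1 z.
    have [r [zr [q _ qr]]] := @dense_rat R _ (ex_intro _ z (ballxx z n0))
      (ball_open z _).
    by exists q; rewrite qr; exact: ball_sym.
  have [[qx hx] [qy hy]] := (near_rat x, near_rat y).
  exists (qx, qy, n) => //= -[u v] [/= hu hv]; apply: eU.
  have tri (q z w : R) : ball q n.+1%:R^-1 z -> ball q n.+1%:R^-1 w -> ball z e w.
    rewrite /ball/= => qz qw; rewrite [e]splitr.
    apply: le_lt_trans (ler_distD q _ _) _; rewrite distrC.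
    by rewrite ltrD// (lt_trans _ ne).
  by split; [exact: tri hx hu|exact: tri hy hv].
rewrite bigcup_mkcond; apply: countable_bigcupT_measurable => // k.
case: ifPn => // _; apply: measurableX; apply: open_measurable; exact: ball_open.
Qed.

Lemma continuous_measurable_plane g : continuous g ->
  measurable_fun setT (g : measurableTypeR R * measurableTypeR R -> R).
Proof.
move=> /continuousP cg; apply: (measurability _ (RGenOpens.measurableE R)).
move=> _ [_ [a [b ->]] <-]; rewrite setTI.
apply: open_measurable_plane; apply: cg; exact: interval_open.
Qed.

Lemma plane_integral_bound g (B : set (measurableTypeR R * measurableTypeR R)) C :
  continuous g -> measurable B -> (plane_measure B < +oo)%E ->
  (forall p, `|g p| <= C * \1_B p) ->
  plane_measure.-integrable setT (EFin \o g) /\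
  `|Rintegral plane_measure setT g| <= C * fine (plane_measure B).
Proof.
move=> cg mB Boo gC.
have iB : plane_measure.-integrable setT (EFin \o (fun p => \1_B p : R)).
  apply/integrableP; split; first exact/measurable_EFinP/measurable_indic.
  under eq_integral do rewrite /= ger0_norm//.
  by rewrite integral_indic// setIT.
have iCB : plane_measure.-integrable setT (EFin \o (fun p => C * \1_B p : R)).
  have := integrableZl measurableT C iB.
  by apply: eq_integrable => // p _; rewrite /= EFinM.
have ig : plane_measure.-integrable setT (EFin \o g).
  apply: (le_integrable _ _ _ iCB) => //.
    by apply/measurable_EFinP; have := continuous_measurable_plane cg.
  move=> p _; rewrite /= lee_fin (le_trans (gC p))//; exact: ler_norm.
split => //.
apply: le_trans (le_normr_Rintegral _ ig) _ => //.
apply: (@le_trans _ _ (Rintegral plane_measure setT (fun p => C * \1_B p : R))).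
  apply: le_Rintegral => //.
  by move/integrable_norm : ig.
rewrite RintegralZl// /Rintegral/= integral_indic// setIT//.
Qed.

End plane_integral.

Section testfun_theory.
Context {R : realType}.
Implicit Types (phi psi : testfun R) (phis : nat -> testfun R).

Lemma testfun_smooth phi : smooth phi.
Proof. by have /test_functionP[] := testfun_in phi. Qed.

Lemma testfun_compact phi : compact (tsupport phi).
Proof. by have /test_functionP[] := testfun_in phi. Qed.

Lemma testfun_linE (c : R) phi psi :
  (c *: phi + psi : testfun R) = c *: (phi : R * R -> R) + psi :> (R * R -> R).
Proof. by []. Qed.

(* Convergence to 0 in the test space: supports in a common compact set and
   uniform convergence of every partial derivative. Linear functionals are
   continuous on the test space iff they are sequentially continuous at 0. *)
Definition testfun_cvg0 phis : Prop :=
  (exists2 K, compact K & forall n, tsupport (phis n) `<=` K) /\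
  forall w e, 0 < e ->
    \forall n \near \oo, forall p, `|partials w (phis n) p| < e.

Lemma testfun_partial_in i phi : partial i phi \in @test_function R.
Proof.
apply/test_functionP; split; first exact/smooth_partial/testfun_smooth.
apply: subtsupport_compact (@testfun_compact phi) _; exact: tsupport_partial.
Qed.

Definition testfun_partial i phi : testfun R := TestFun (testfun_partial_in i phi).

End testfun_theory.

Record plane_distribution (R : realType) := Distribution {
  dist_fun :> testfun R -> R;
  dist_scalar : scalar dist_fun;
  dist_continuous : forall phis : nat -> testfun R,
    testfun_cvg0 phis -> dist_fun (phis n) @[n --> \oo] --> (0 : R) }.

Section distribution_theory.
Context {R : realType}.
Implicit Types (T : plane_distribution R) (phi psi : testfun R).

Lemma distribution_eq T1 T2 : T1 =1 T2 -> T1 = T2.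
Proof.
case: T1 T2 => [f1 s1 c1] [f2 s2 c2] /= /funext f12.
by subst f2; congr Distribution; exact: Prop_irrelevance.
Qed.

Section derivative.
Variables (i : axis) (T : plane_distribution R).

Definition dist_partial_fun phi : R := - T (testfun_partial i phi).

Lemma testfun_partial_lin (c : R) phi psi :
  testfun_partial i (c *: phi + psi) =
  c *: testfun_partial i phi + testfun_partial i psi.
Proof.
apply/val_inj => /=.
exact: (@partials_lin _ c phi psi [:: i] (@testfun_smooth _ _) (@testfun_smooth _ _)).
Qed.

Lemma dist_partial_scalar : scalar dist_partial_fun.
Proof.
move=> c phi psi; rewrite /dist_partial_fun testfun_partial_lin dist_scalar.
by rewrite opprD mulrN.
Qed.

Lemma dist_partial_continuous (phis : nat -> testfun R) :
  testfun_cvg0 phis -> dist_partial_fun (phis n) @[n --> \oo] --> (0 : R).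
Proof.
move=> [[K cK phiK] phi0]; rewrite -oppr0; apply: cvgN.
apply: dist_continuous; split.
  by exists K => // n; apply: subset_trans (phiK n); exact: tsupport_partial.
move=> w e e0; apply: filterS (phi0 (w ++ [:: i]) e e0) => n + p => /(_ p).
by rewrite -partials_cat.
Qed.

Definition dist_partial : plane_distribution R :=
  Distribution dist_partial_scalar dist_partial_continuous.

End derivative.

Section regular.
Variables (F : R * R -> R) (cF : continuous F).

Definition regular_fun phi : R :=
  \int[plane_measure]_p (F p * phi p).

Lemma compact_box (K : set (R * R)) : compact K ->
  exists B : set (measurableTypeR R * measurableTypeR R),
    [/\ measurable B, (plane_measure B < +oo)%E & K `<=` B].
Proof.
move=> /compact_bounded/ex_strict_bound_gt0[M M0 KM].
have mB : measurable (ball (0 : R) M : set (measurableTypeR R)).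
  apply: open_measurable; exact: ball_open.
exists (ball (0 : R) M `*` ball (0 : R) M); split.
- exact: measurableX.
- have mu : lebesgue_measure (ball (0 : R) M) = (M *+ 2)%:E.
    exact: lebesgue_measure_ball (ltW M0).
  suff -> : plane_measure (ball (0 : R) M `*` ball (0 : R) M) = ((M *+ 2)%:E * (M *+ 2)%:E)%E.
    by rewrite -EFinM ltry.
  rewrite -mu; exact: product_measure1E.
- move=> [x y] /KM /=; rewrite prod_normE/= gt_max => /andP[xM yM].
  by split; rewrite /ball /= sub0r normrN.
Qed.

Lemma continuous_compact_bound (K : set (R * R)) : compact K ->
  exists2 M, 0 < M & forall p, K p -> `|F p| < M.
Proof.
move=> cK.
have : compact (F @` K).
  by apply: continuous_compact => //; exact/continuous_subspaceT.
move=> /compact_bounded/ex_strict_bound_gt0[M M0 KM].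
by exists M => // p Kp; apply: KM; exists p.
Qed.

Lemma regular_bound (K : set (R * R)) : compact K ->
  exists2 M, 0 < M & forall phi e, tsupport phi `<=` K ->
    (forall p, `|phi p| <= e) ->
    plane_measure.-integrable setT (EFin \o (fun p => F p * phi p)) /\
    `|regular_fun phi| <= M * e.
Proof.
move=> cK.
have [B [mB Boo KB]] := compact_box cK.
have [M M0 FM] := continuous_compact_bound cK.
exists (M * (fine (plane_measure B) + 1)).
  by rewrite mulr_gt0// ltr_pwDr// fine_ge0.
move=> phi e phiK phie.
have e0 : 0 <= e by exact: le_trans (phie (0, 0)).
have cFphi : continuous (fun p => F p * phi p).
  move=> p; apply: continuousM; first exact: cF.
  exact: differentiable_continuous (@testfun_smooth _ phi [::] p).
have bFphi p : `|F p * phi p| <= M * e * \1_B p.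
  rewrite normrM indicE; have [pB|pB] := boolP (p \in B).
    have [phi0|phi0] := eqVneq (phi p) 0.
      by rewrite phi0 normr0 mulr0 mulr1 mulr_ge0// ltW.
    rewrite mulr1 ler_pM// ltW//; apply: FM; apply: phiK.
    exact: (@subset_closure _ [set p | phi p != 0]).
  rewrite (@tsupport_eq0 _ phi) ?normr0 ?mulr0// => /phiK/KB.
  by move: pB; rewrite notin_setE; exact.
have [iF bF] := plane_integral_bound cFphi mB Boo bFphi.
split => //; apply: le_trans bF _.
rewrite [leRHS]mulrAC ler_wpM2l//; first by rewrite mulr_ge0// ltW.
by rewrite lerDl.
Qed.

Lemma regular_integrable phi :
  plane_measure.-integrable setT (EFin \o (fun p => F p * phi p)).
Proof.
have [M _ h] := regular_bound (@testfun_compact _ phi).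
have [B B0 phiB] : exists2 B, 0 < B & forall p, `|phi p| <= B.
  have cphi : continuous phi.
    by move=> p; exact: differentiable_continuous (@testfun_smooth _ phi [::] p).
  have : compact (phi @` tsupport phi).
    apply: continuous_compact; last exact: testfun_compact.
    exact/continuous_subspaceT.
  move=> /compact_bounded/ex_strict_bound_gt0[B B0 KB].
  exists B => // p; have [->|phi0] := eqVneq (phi p) 0.
    by rewrite normr0 ltW.
  apply/ltW/KB; exists p => //.
  exact: (@subset_closure _ [set p | phi p != 0]).
by have [] := h phi B _ phiB.
Qed.

Lemma regular_scalar : scalar regular_fun.
Proof.
move=> c phi psi; rewrite /regular_fun.
have iphi := regular_integrable phi; have ipsi := regular_integrable psi.
have icphi : plane_measure.-integrable setT
    (EFin \o (fun p => c * (F p * phi p))).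
  have := integrableZl measurableT c iphi.
  by apply: eq_integrable => // p _; rewrite /= EFinM.
rewrite -(RintegralZl _ _ iphi)// -RintegralD//.
by apply: eq_Rintegral => p _ /=; rewrite mulrDr mulrCA.
Qed.

Lemma regular_continuous (phis : nat -> testfun R) :
  testfun_cvg0 phis -> regular_fun (phis n) @[n --> \oo] --> (0 : R).
Proof.
move=> [[K cK phiK] phi0]; have [M M0 h] := regular_bound cK.
apply/cvgrPdist_lt => e e0.
have eM0 : 0 < e / (M + M) by rewrite divr_gt0// addr_gt0.
apply: filterS (phi0 [::] _ eM0) => n hn; rewrite sub0r normrN.
have phie p : `|phis n p| <= e / (M + M) by exact: ltW (hn p).
have [_ /le_lt_trans->//] := h (phis n) _ (phiK n) phie.
by rewrite mulrCA gtr_pMr// ltr_pdivrMr ?addr_gt0// mul1r ltrDl.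
Qed.

Definition regular_dist : plane_distribution R :=
  Distribution regular_scalar regular_continuous.

End regular.

End distribution_theory.

Definition affine_fun {R : realType} (M : 'M[R]_2) (t p : R * R) : R * R :=
  (M 0 0 * p.1 + M 0 1 * p.2 + t.1, M 1 0 * p.1 + M 1 1 * p.2 + t.2).

Record affine_bij (R : realType) := AffineBij {
  aff_mx : 'M[R]_2;
  aff_shift : R * R;
  aff_unit : aff_mx \in unitmx }.

Definition aff_fun (R : realType) (A : affine_bij R) : R * R -> R * R :=
  affine_fun (aff_mx A) (aff_shift A).

Coercion aff_fun : affine_bij >-> Funclass.

Section affine.
Context {R : realType}.
Implicit Types (A : affine_bij R) (phi : testfun R).

(* Determinant of the linear part. *)
Definition aff_det A : R := \det (aff_mx A).

Definition aff_inv A : affine_bij R :=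
  @AffineBij R (invmx (aff_mx A))
    (affine_fun (invmx (aff_mx A)) 0 (- aff_shift A))
    (etrans (unitmx_inv (aff_mx A)) (aff_unit A)).

Lemma mx2E (M N : 'M[R]_2) i j :
  (M *m N) i j = M i 0 * N 0 j + M i 1 * N 1 j.
Proof. by rewrite mxE big_ord_recl big_ord1 (_ : lift _ _ = 1)//; exact/val_inj. Qed.

Lemma affine_fun_comp (M N : 'M[R]_2) (s t p : R * R) :
  affine_fun M s (affine_fun N t p) = affine_fun (M *m N) (affine_fun M s t) p.
Proof. by rewrite /affine_fun/= !mx2E; congr pair; ring. Qed.

Lemma affine_fun1 (t p : R * R) : affine_fun 1%:M t p = p + t.
Proof.
by case: p => x y; rewrite /affine_fun !mxE/= !mul1r !mul0r !addr0 add0r.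
Qed.

Lemma aff_invK A : cancel (aff_inv A) A.
Proof.
case: A => M t uM p; rewrite /aff_fun/= !affine_fun_comp mulmxV// !affine_fun1.
rewrite (_ : affine_fun M t 0 = t) ?addNr ?addr0//.
by rewrite /affine_fun/= !mulr0 !add0r -surjective_pairing.
Qed.

Lemma aff_K A : cancel A (aff_inv A).
Proof.
case: A => M t uM p; rewrite /aff_fun/= !affine_fun_comp mulVmx// affine_fun1.
rewrite [X in _ + X](_ : _ = 0) ?addr0//.
by rewrite /affine_fun/=; congr pair; rewrite /=; ring.
Qed.

Lemma aff_differentiable A p : differentiable A p.
Proof.
have dlin (a b c : R) : differentiable (fun q : R * R => a * q.1 + b * q.2 + c) p.
  apply: differentiableD; last exact: differentiable_cst.
  apply: differentiableD.
    apply: (@differentiableZ _ _ _ fst a p).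
    apply: (@linear_differentiable _ _ _ fst) => q; exact: cvg_fst.
  apply: (@differentiableZ _ _ _ snd b p).
  apply: (@linear_differentiable _ _ _ snd) => q; exact: cvg_snd.
exact: differentiable_pair.
Qed.

Lemma aff_continuous A : continuous A.
Proof. by move=> p; exact/differentiable_continuous/aff_differentiable. Qed.

Lemma partial_comp_aff A (f : R * R -> R) i : smooth f ->
  partial i (f \o A) = let j := if i is axis1 then 0 else 1 in
    aff_mx A 0 j *: (partial axis1 f \o A) + aff_mx A 1 j *: (partial axis2 f \o A).
Proof.
move=> sf; set j := if _ is axis1 then _ else _; apply/funext => p.
rewrite /partial !fctE/=.
have df : differentiable f (A p) by exact: (sf [::] (A p)).
pose v : R * R := (aff_mx A 0 j, aff_mx A 1 j).
transitivity ('D_v f (A p)).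
  have Av h : A (h *: unit_vec i + p) = h *: v + A p.
    rewrite /aff_fun/affine_fun/v/j.
    by case: i {j v}; congr pair; rewrite /= /GRing.scale/=; ring.
  rewrite /derive; set g1 := (X in lim (X @ _)); set g2 := (X in _ = lim (X @ _)).
  suff -> : g1 = g2 by [].
  by apply/funext => h; rewrite /g1 /g2 /= Av.
rewrite !deriveE//.
have -> : v = aff_mx A 0 j *: unit_vec axis1 + aff_mx A 1 j *: unit_vec axis2.
  rewrite /v /unit_vec; congr pair => /=; rewrite scaler0 ?addr0 ?add0r;
    exact/esym/mulr1.
by rewrite linearD !linearZ.
Qed.

Lemma partials_comp_aff A w : exists s : seq (R * seq axis),
  forall f : R * R -> R, smooth f ->
    partials w (f \o A) = \sum_(k <- s) k.1 *: (partials k.2 f \o A).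
Proof.
elim: w => [|i w [s IH]].
  exists [:: (1, [::])] => f _.
  by rewrite big_seq1 scale1r.
set j : 'I_2 := if i is axis1 then 0 else 1.
exists (flatten [seq [:: (k.1 * aff_mx A 0 j, axis1 :: k.2);
                         (k.1 * aff_mx A 1 j, axis2 :: k.2)] | k <- s]).
move=> f sf; rewrite [partials _ _]/= IH//.
elim: s {IH} => [|k s IH]; first by rewrite !big_nil -[partial i 0]/(partials [:: i] 0) partials0.
have sk (l : R * seq axis) p : differentiable (partials l.2 f \o A) p.
  by apply: differentiable_comp; [exact: aff_differentiable|exact: sf].
have dsum p : differentiable (\sum_(l <- s) l.1 *: (partials l.2 f \o A)) p.
  elim: (s) => [|l t IHt]; first by rewrite big_nil; exact: (@differentiable_cst _ _ _ (0 : R)).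
  by rewrite big_cons; apply: differentiableD => //; exact: differentiableZ.
rewrite !big_cons /= -IH addrA.
have -> : partial i (k.1 *: (partials k.2 f \o A) + \sum_(l <- s) l.1 *: (partials l.2 f \o A)) =
  k.1 *: partial i (partials k.2 f \o A) + partial i (\sum_(l <- s) l.1 *: (partials l.2 f \o A)).
  apply/funext => p; rewrite /partial deriveD.
  - by rewrite deriveZ//; exact: diff_derivable.
  - by apply: derivableZ; exact: diff_derivable.
  - exact: diff_derivable.
congr (_ + _); rewrite partial_comp_aff/= -/j.
  by rewrite scalerDr !scalerA.
by move=> w' p; rewrite partials_cat.
Qed.

Lemma smooth_comp_aff A (f : R * R -> R) : smooth f -> smooth (f \o A).
Proof.
move=> sf w p; have [s ->//] := partials_comp_aff A w.
elim: s => [|l t IHt]; first by rewrite big_nil; exact: (@differentiable_cst _ _ _ (0 : R)).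
rewrite big_cons; apply: differentiableD => //; apply: differentiableZ.
by apply: differentiable_comp; [exact: aff_differentiable|exact: sf].
Qed.

Lemma tsupport_comp_aff A (f : R * R -> R) (K : set (R * R)) :
  compact K -> tsupport f `<=` K -> tsupport (f \o A) `<=` aff_inv A @` K.
Proof.
move=> cK fK; have cAK : compact (aff_inv A @` K).
  by apply: continuous_compact => //; exact/continuous_subspaceT/aff_continuous.
have /closure_id -> : closed (aff_inv A @` K).
  by apply: compact_closed => //; exact: norm_hausdorff.
apply: closure_subset => p /= fp; exists (A p); last exact: aff_K.
by apply: fK; exact: (@subset_closure _ [set p | f p != 0]).
Qed.

Lemma testfun_comp_in A phi : phi \o A \in @test_function R.
Proof.
apply/test_functionP; split; first exact/smooth_comp_aff/testfun_smooth.
apply: (@subtsupport_compact _ (aff_inv A @` tsupport phi)).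
  apply: continuous_compact; last exact: testfun_compact.
  exact/continuous_subspaceT/aff_continuous.
by apply: tsupport_comp_aff => //; exact: testfun_compact.
Qed.

Definition testfun_comp phi A : testfun R := TestFun (testfun_comp_in A phi).

Section composition.
Variables (T : plane_distribution R) (A : affine_bij R).

(* T o A, from the change of variables |det A|^-1 <T, phi o A^-1>. *)
Definition dist_comp_fun phi : R :=
  `|aff_det A|^-1 * T (testfun_comp phi (aff_inv A)).

Lemma dist_comp_scalar : scalar dist_comp_fun.
Proof.
move=> c phi psi; rewrite /dist_comp_fun mulrCA -mulrDr -dist_scalar.
by congr (_ * T _); exact/val_inj.
Qed.

Lemma dist_comp_continuous (phis : nat -> testfun R) :
  testfun_cvg0 phis -> dist_comp_fun (phis n) @[n --> \oo] --> (0 : R).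
Proof.
move=> [[K cK phiK] phi0]; rewrite -(mulr0 `|aff_det A|^-1); apply: cvgMr.
apply: dist_continuous; split.
  exists (aff_inv (aff_inv A) @` K) => [|n].
    by apply: continuous_compact => //; exact/continuous_subspaceT/aff_continuous.
  exact: tsupport_comp_aff.
move=> w; have [s hs] := partials_comp_aff (aff_inv A) w.
suff : forall e, 0 < e -> \forall n \near \oo, forall p,
    `|(\sum_(k <- s) k.1 *: (partials k.2 (phis n) \o aff_inv A)) p| < e.
  move=> h e e0; apply: filterS (h e e0) => n hn p.
  by rewrite /= hs//; exact: testfun_smooth.
move: phi0 => {hs phiK} phi0; move: s.
elim=> [|k s IH] e e0.
  by apply: nearW => n p; rewrite big_nil normr0.
have e20 : 0 < e / 2 by rewrite divr_gt0.
have ek0 : 0 < e / 2 / (`|k.1| + 1) by rewrite divr_gt0// ltr_pwDr.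
apply: filterS2 (IH _ e20) (phi0 k.2 _ ek0) => n h1 h2 p.
rewrite big_cons [e]splitr; apply: le_lt_trans (ler_normD _ _) _.
apply: ler_ltD => //; rewrite /= normrM.
apply: le_trans (ler_wpM2l _ (ltW (h2 _))) _ => //.
by rewrite mulrCA ger_pMr// ler_pdivrMr ?ltr_pwDr// mul1r lerDl.
Qed.

Definition dist_comp : plane_distribution R :=
  Distribution dist_comp_scalar dist_comp_continuous.

End composition.

End affine.

Section primitive_integral.
Context {R : realType}.
Implicit Types (F : \bar R * \bar R -> R) (f : plane_distribution R).

Definition Bc : set (\bar R * \bar R -> R) :=
  [set F | continuous F /\ forall s, F (-oo%E, s) = 0 /\ F (s, -oo%E) = 0].

Definition plane_restr F (p : R * R) : R := F (p.1%:E, p.2%:E).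

Lemma plane_restr_continuous F : continuous F -> continuous (plane_restr F).
Proof.
move=> cF p; rewrite /plane_restr.
apply: (@continuous_comp _ _ _ (fun q : R * R => (q.1%:E, q.2%:E)) F); last exact: cF.
apply: (@cvg_pair _ _ _ (nbhs p) (nbhs p.1%:E) (nbhs p.2%:E)) => A.
- by move=> /(cvg_fst (F := nbhs p.1) (G := nbhs p.2)).
- by move=> /(cvg_snd (F := nbhs p.1) (G := nbhs p.2)).
Qed.

Definition dist_partial12 F (cF : continuous F) : plane_distribution R :=
  dist_partial axis1 (dist_partial axis2
    (regular_dist (plane_restr_continuous cF))).

Definition primitives f : set (\bar R * \bar R -> R) :=
  [set F | exists BF : Bc F, f = dist_partial12 BF.1].

Definition Ac : set (plane_distribution R) := [set f | primitives f !=set0].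

(* For f in Ac the primitive is unique, so the choice made by xget is
   immaterial; outside Ac the value is a dummy. *)
Definition primitive f : \bar R * \bar R -> R := xget (cst 0) (primitives f).

(* The integral of f over [a, b] x [c, d], first pair of bounds for the first
   variable. No order between the bounds is required: exchanging a and b, or
   c and d, changes the sign, which is the usual orientation convention. *)
Definition cp_integral f (a b c d : \bar R) : R :=
  let F := primitive f in F (a, c) + F (b, d) - F (a, d) - F (b, c).

End primitive_integral.

(* Main.v *)
Require Import Defs.
From mathcomp Require Import all_boot all_order all_algebra.
From mathcomp Require Import all_classical all_reals all_analysis.
From mathcomp Require Import measurable_realfun ring lra.
Set Implicit Arguments.
Unset Strict Implicit.
Unset Printing Implicit Defensive.
Import Order.TTheory GRing.Theory Num.Theory numFieldNormedType.Exports.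
Local Open Scope classical_set_scope.
Local Open Scope ring_scope.

(** Let F be a primitive of f.  By the chain rule the function F o Psi divided by
    alpha * beta ought to be a primitive of f o Psi, and since the corners of the
    u-v-rectangle are mapped by Psi to the corners of [a, b] x [c, d], both
    integrals are the same combination of four values of F.  Three points have
    to be justified.

    Chain rule ([dist_comp_partial12]).  Write a test function phi as chi o Psi.
    As Psi is axis-parallel, the mixed derivative of chi o Psi is alpha * beta
    times that of chi, composed with Psi; when Psi exchanges the axes this uses
    the symmetry of second derivatives ([partial_commute]).  The pairings then
    agree by the substitution formula for Lebesgue integrals
    ([Rintegral_axis_affine], [Rintegral_swap_affine]), which comes from the
    uniqueness of the product measure.

    Membership in Bc ([dist_partial12_normalized]).  Psi extends continuously to
    the compactified plane, but for a negative alpha or beta it exchanges the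
    points -oo and +oo, so F o Psi need not vanish on the two lines at -oo.
    Subtracting its values on these lines repairs this.  The subtracted terms
    depend on one coordinate only, so they change neither the mixed derivative,
    by Fubini and the fundamental theorem of calculus
    ([Rintegral_partial1_eq0], [Rintegral_partial2_eq0]), nor the alternating sum
    over the corners of a rectangle.

    Independence of the primitive ([integral_of_primitive]).  The integral is
    defined through a chosen primitive, so it must be known that the alternating
    sum over the corners of a finite rectangle depends on the distribution alone.
    This is [cross_difference_eq0]: if a continuous G has zero mixed derivative
    then its alternating sum vanishes.  It is proved by pairing G with
    P(x) Q(y), where P is the difference of two translates of a smooth step, one
    step up at a and one at b, and Q likewise for c and d.  The mixed derivative
    of P(x) Q(y) is an alternating sum of four copies of one nonnegative bump,
    placed at the corners, so after translation the pairing is the integral of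
    the alternating sum, with the rectangle moved a little, against this bump.
    An alternating sum of nonzero value would keep its sign for small moves, and
    the integral would not be zero. *)

(** * Smooth functions of one real variable *)

Section smooth_line.
Context {R : realType}.
Implicit Types (f g : R -> R) (n k : nat) (x : R).

(** Smoothness through a hierarchy of finite orders, so that the closure under
    products and inverses follows by induction on the order, the rules of
    derivation lowering it by one. *)
Fixpoint times_derivable n f : Prop :=
  if n is n'.+1 then (forall x, derivable f x 1) /\ times_derivable n' (derive1 f)
  else True.

Definition smooth1 f := forall n, times_derivable n f.

Lemma times_derivableW n f : times_derivable n.+1 f -> times_derivable n f.
Proof. by elim: n f => // n IH f [df /IH dn]; split. Qed.

Lemma times_derivableD n f g :
  times_derivable n f -> times_derivable n g -> times_derivable n (f \+ g).
Proof.
elim: n f g => // n IH f g [df dnf] [dg dng]; split=> [x|].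
  exact: derivableD.
rewrite (_ : derive1 _ = derive1 f \+ derive1 g); first exact: IH.
by apply/funext => x; rewrite derive1E deriveD// /= !derive1E.
Qed.

Lemma times_derivableM n f g :
  times_derivable n f -> times_derivable n g -> times_derivable n (f \* g).
Proof.
elim: n f g => // n IH f g fn gn; have [[df dnf] [dg dng]] := (fn, gn).
split=> [x|]; first exact: derivableM.
rewrite (_ : derive1 _ = (f \* derive1 g) \+ (g \* derive1 f)).
  by apply: times_derivableD; apply: IH => //; exact: times_derivableW.
by apply/funext => x; rewrite derive1E deriveM// /= !derive1E.
Qed.

Lemma times_derivable_cst n (c : R) : times_derivable n (cst c).
Proof.
elim: n c => // n IH c; split=> [x|]; first exact: derivable_cst.
rewrite (_ : derive1 _ = cst 0)//.
by apply/funext => x; rewrite derive1_cst.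
Qed.

Lemma times_derivableZ n (c : R) f :
  times_derivable n f -> times_derivable n (fun x => c * f x).
Proof. by apply: times_derivableM; exact: times_derivable_cst. Qed.

Lemma times_derivableV n f : (forall x, f x != 0) ->
  times_derivable n f -> times_derivable n (fun x => (f x)^-1).
Proof.
move=> f0; elim: n => // n IH fn; have [df dnf] := fn.
split=> [x|]; first exact: derivableV.
have fVn := IH (times_derivableW fn).
rewrite (_ : derive1 _ =
  fun x => -1 * (((fun x => (f x)^-1) \* (fun x => (f x)^-1)) \* derive1 f) x).
  by apply/times_derivableZ/times_derivableM => //; exact: times_derivableM.
apply/funext => x; rewrite derive1E deriveV// -derive1E mulN1r /=.
by rewrite expr2 invfM /GRing.scale/= mulNr.
Qed.

Lemma derive1_comp_affine f (s t x : R) : (forall y, derivable f y 1) ->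
  is_derive x 1 (fun y => f (s * y + t)) (s * derive1 f (s * x + t)).
Proof.
move=> df.
have h1 : is_derive (s * x + t) 1 f (derive1 f (s * x + t)).
  by rewrite derive1E; exact: derivableP.
have h2 : is_derive x 1 (fun y => s * y + t) s.
  have := is_deriveD (is_deriveZ s (is_derive_id x (1 : R))) (is_derive_cst t x 1).
  by move=> /is_derive_eq; apply; rewrite addr0; exact: mulr1.
by rewrite mulrC; exact: (@is_derive1_comp _ f (fun y => s * y + t)).
Qed.

Lemma times_derivable_comp_affine n f (s t : R) :
  times_derivable n f -> times_derivable n (fun x => f (s * x + t)).
Proof.
elim: n f => // n IH f [df dnf]; split=> [x|].
  exact: (@ex_derive _ _ _ _ _ _ _ (derive1_comp_affine s t x df)).
rewrite (_ : derive1 _ = fun x => s * (fun y => derive1 f (s * y + t)) x).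
  exact/times_derivableZ/IH.
apply/funext => x; rewrite derive1E; apply: derive_val.
exact: (derive1_comp_affine s t x df).
Qed.

(** Smoothness of exp (-1/x), extended by 0, needs its derivatives at 0.  The
    family with the extra factor x^-k is closed under derivation up to linear
    combinations, so one derivative computation for all k is enough. *)
Definition flat k x : R := if 0 < x then x ^- k * expR (- x^-1) else 0.

(** The exponential series gives exp (1/x) >= (1/x)^(k+2) / (k+2)!.  The order 2
    in the resulting bound is what makes the derivative at 0 vanish. *)
Lemma flat_le k x : `|flat k x| <= (k.+2)`!%:R * x ^+ 2.
Proof.
rewrite /flat; case: ifPn => [x0|_]; last first.
  by rewrite normr0 mulr_ge0// sqr_ge0.
rewrite ger0_norm ?mulr_ge0 ?expR_ge0 ?invr_ge0 ?exprn_ge0 ?(ltW x0)//.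
rewrite expRN.
have x'0 : 0 < x^-1 by rewrite invr_gt0.
have := expR_ge1Dxn k.+1 (ltW x'0).
have F0 : (0 : R) < (k.+2)`!%:R by rewrite ltr0n fact_gt0.
have X0 : 0 < x ^+ k by rewrite exprn_gt0.
move=> h; have {}h : x^-1 ^+ k.+2 / (k.+2)`!%:R <= expR x^-1.
  by apply: le_trans h; rewrite lerDr.
have E0 : 0 < expR x^-1 by exact: expR_gt0.
rewrite -invfM invf_ple ?posrE ?mulr_gt0 ?exprn_gt0//.
rewrite invfM -exprVn mulrC.
rewrite -ler_pdivrMl//; apply: le_trans h; rewrite le_eqVlt; apply/orP; left.
by rewrite mulrA -exprVn -exprD addn2.
Qed.

Lemma is_derive_flat k x :
  is_derive x 1 (flat k) (flat k.+2 x - k%:R * flat k.+1 x).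
Proof.
have [x0|x0|<-] := ltgtP 0 x.
- have xn0 : x != 0 by rewrite gt_eqF.
  have near_flat : \near x, (fun y : R => y ^- k * expR (- y^-1)) x = flat k x.
    near=> y; rewrite /flat ifT//; near: y; exact: lt_nbhsr.
  apply: near_eq_is_derive near_flat _; rewrite /flat x0.
  have d1 : is_derive x 1 (fun y : R => y^-1) (- x ^- 2).
    have := @is_deriveV _ id x 1 1 xn0 (is_derive_id _ _).
    by rewrite /GRing.scale/= mulr1.
  have d2 : is_derive x 1 (fun y : R => expR (- y^-1)) (expR (- x^-1) * x ^- 2).
    have := @is_derive1_comp _ expR (fun y => - y^-1) x _ _ (is_derive_expR _) (is_deriveN d1).
    by rewrite /= opprK.
  have d3 : is_derive x 1 (fun y : R => y ^- k) (- (k%:R * x ^- k.+1)).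
    have xk0 : x ^+ k != 0 by rewrite expf_neq0.
    have dX : is_derive x 1 (fun y : R => y ^+ k) (k%:R * x ^+ k.-1).
      split; first exact: exprn_derivable.
      by rewrite exp_derive; exact: mulr1.
    have := @is_deriveV _ _ x _ 1 xk0 dX.
    move=> /is_derive_eq; apply; rewrite /GRing.scale/=.
    case: k {xk0 dX} => [|k]; first by rewrite !mul0r mulr0 oppr0.
    by rewrite /= !exprS; field; rewrite expf_neq0 //= xn0.
  have := is_deriveM d3 d2.
  move=> /is_derive_eq; apply; rewrite /GRing.scale/= !exprS; field.
  by rewrite expf_neq0 //= xn0.
- have near_flat : \near x, cst 0 x = flat k x.
    near=> y; rewrite /flat ifN// -leNgt ltW//; near: y; exact: lt_nbhsl.
  apply: near_eq_is_derive near_flat _.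
  by rewrite /flat ltNge (ltW x0)/= mulr0 subrr; exact: is_derive_cst.
- rewrite /flat ltxx mulr0 subrr.
  (* At 0 the difference quotient is bounded by a multiple of its increment. *)
  suff h : h^-1 *: ((flat k \o shift 0) (h *: 1) - flat k 0) @[h --> 0^'] --> (0 : R).
    apply: DeriveDef; last exact/cvg_lim.
    by apply/cvg_ex; exists 0.
  apply/cvgrPdist_le => e e0.
  have F0 : (0 : R) < (k.+2)`!%:R by rewrite ltr0n fact_gt0.
  near=> t; have t0 : t != 0 by near: t; exact: nbhs_dnbhs_neq.
  rewrite sub0r normrN /= addr0 [X in _ - X]/flat ltxx subr0 /GRing.scale/= mulr1.
  rewrite normrM normfV ler_pdivrMl ?normr_gt0//.
  apply: le_trans (flat_le _ _) _.
  rewrite -[x in _ * x]real_normK ?num_real// expr2 mulrCA ler_pM2l ?normr_gt0//.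
  rewrite -ler_pdivlMl//.
  by near: t; apply: dnbhs0_le; rewrite mulr_gt0// invr_gt0.
Unshelve. all: by end_near. Qed.

Lemma smooth1_flat k : smooth1 (flat k).
Proof.
move=> n; elim: n k => // n IH k; split=> [x|].
  exact: (@ex_derive _ _ _ _ _ _ _ (is_derive_flat k x)).
rewrite (_ : derive1 _ = flat k.+2 \+ (fun x => - k%:R * flat k.+1 x)).
  by apply: times_derivableD; [|apply: times_derivableZ]; exact: IH.
apply/funext => x; rewrite derive1E/= mulNr.
exact: (@derive_val _ _ _ _ _ _ _ (is_derive_flat k x)).
Qed.

Lemma flat_gt0 k x : 0 < x -> 0 < flat k x.
Proof. by move=> x0; rewrite /flat x0 mulr_gt0 ?expR_gt0// invr_gt0 exprn_gt0. Qed.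

Lemma flat_eq0 k x : x <= 0 -> flat k x = 0.
Proof. by move=> x0; rewrite /flat ltNge x0. Qed.

Lemma flat_ge0 k x : 0 <= flat k x.
Proof. by have [/(flat_eq0 k)->//|/(flat_gt0 k)/ltW] := leP x 0. Qed.

Lemma flat_sum_gt0 x : 0 < flat 0 x + flat 0 (- 1 * x + 1).
Proof.
have [x0|x0] := leP x 0.
  by rewrite ltr_wpDl ?flat_ge0// flat_gt0//; lra.
by rewrite ltr_pwDl ?flat_ge0// flat_gt0.
Qed.

(** The classical smooth step: 0 on the left of 0 and 1 on the right of 1.  As a
    quotient it needs no integration to be constructed, and its derivative plays
    the role of the usual bump function. *)
Definition smooth_step x : R := flat 0 x / (flat 0 x + flat 0 (- 1 * x + 1)).

Lemma smooth1_step : smooth1 smooth_step.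
Proof.
move=> n; apply: times_derivableM; first exact: smooth1_flat.
apply: times_derivableV; first by move=> x; rewrite gt_eqF// flat_sum_gt0.
apply: times_derivableD; first exact: smooth1_flat.
exact/times_derivable_comp_affine/smooth1_flat.
Qed.

Lemma smooth_step_le0 x : x <= 0 -> smooth_step x = 0.
Proof. by move=> x0; rewrite /smooth_step flat_eq0// mul0r. Qed.

Lemma smooth_step_ge1 x : 1 <= x -> smooth_step x = 1.
Proof.
move=> x1; rewrite /smooth_step (@flat_eq0 0 (- 1 * x + 1)); last by lra.
by rewrite addr0 divff// gt_eqF// flat_gt0//; lra.
Qed.

Lemma smooth1_derivable f : smooth1 f -> forall x, derivable f x 1.
Proof. by move=> /(_ 1%N)[]. Qed.

Lemma smooth1_derive f : smooth1 f -> smooth1 (derive1 f).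
Proof. by move=> sf n; have [] := sf n.+1. Qed.

Lemma derive1_smooth_step x : derive1 smooth_step x =
  (flat 2 x * flat 0 (- 1 * x + 1) + flat 0 x * flat 2 (- 1 * x + 1)) /
  (flat 0 x + flat 0 (- 1 * x + 1)) ^+ 2.
Proof.
have s0 := flat_sum_gt0 x.
have d0 (y : R) : is_derive y 1 (flat 0) (flat 2 y).
  by have := is_derive_flat 0 y; rewrite mul0r subr0.
have d1 : is_derive x 1 (fun y => flat 0 (- 1 * y + 1)) (- flat 2 (- 1 * x + 1)).
  have h := @derive1_comp_affine (flat 0) (-1) 1 x
    (smooth1_derivable (smooth1_flat 0)).
  move/is_derive_eq: h; apply.
  by rewrite derive1E (@derive_val _ _ _ _ _ _ _ (d0 _)); exact: mulN1r.
have d2 := is_deriveD (d0 x) d1.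
have d3 := is_deriveM (d0 x) (@is_deriveV _ _ x _ 1 (lt0r_neq0 s0) d2).
rewrite derive1E (@derive_val _ _ _ _ _ _ _ d3) /GRing.scale/= !fctE.
by field; rewrite lt0r_neq0.
Qed.

Lemma derive1_smooth_step_ge0 x : 0 <= derive1 smooth_step x.
Proof.
by rewrite derive1_smooth_step divr_ge0 ?exprn_ge0 ?addr_ge0 ?mulr_ge0 ?flat_ge0.
Qed.

Lemma derive1_smooth_step_gt0 : 0 < derive1 smooth_step 2^-1.
Proof.
rewrite derive1_smooth_step divr_gt0 ?exprn_gt0 ?flat_sum_gt0//.
by rewrite addr_gt0// mulr_gt0// flat_gt0//; lra.
Qed.

Lemma derive1_smooth_step_eq0 x : (x <= 0) || (1 <= x) -> derive1 smooth_step x = 0.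
Proof.
rewrite derive1_smooth_step => /orP[x0|x1].
  by rewrite !(@flat_eq0 _ x)// !mul0r addr0 mul0r.
by rewrite !(@flat_eq0 _ (- 1 * x + 1)) ?mulr0 ?addr0 ?mul0r//; lra.
Qed.

End smooth_line.

(** * Mixed partial derivatives of smooth functions commute *)

Section mixed_partials.
Context {R : realType}.
Implicit Types (f : R * R -> R) (x y h k : R).

Lemma smooth_differentiable f p : smooth f -> differentiable f p.
Proof. by move=> /(_ [::] p). Qed.

Lemma smooth_continuous f : smooth f -> continuous f.
Proof. by move=> sf p; exact/differentiable_continuous/smooth_differentiable. Qed.

(** Along the first unit vector, the directional difference quotient is the
    difference quotient of the section. *)
Lemma is_derive_section1 f x y : differentiable f (x, y) ->
  is_derive x 1 (fun t => f (t, y)) (partial axis1 f (x, y)).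
Proof.
move=> df.
have E : (fun h : R => h^-1 *: (((fun t => f (t, y)) \o shift x) (h *: 1) - f (x, y))) =
         (fun h : R => h^-1 *: ((f \o shift (x, y)) (h *: unit_vec axis1) - f (x, y))).
  apply/funext => h; congr (_ *: (f _ - _)).
  congr pair; rewrite /= ?scaler0 ?add0r//.
have d := diff_derivable (v := unit_vec axis1) df.
split; first by rewrite /derivable E.
by rewrite /partial /derive E.
Qed.

Lemma is_derive_section2 f x y : differentiable f (x, y) ->
  is_derive y 1 (fun t => f (x, t)) (partial axis2 f (x, y)).
Proof.
move=> df.
have E : (fun h : R => h^-1 *: (((fun t => f (x, t)) \o shift y) (h *: 1) - f (x, y))) =
         (fun h : R => h^-1 *: ((f \o shift (x, y)) (h *: unit_vec axis2) - f (x, y))).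
  apply/funext => h; congr (_ *: (f _ - _)).
  congr pair; rewrite /= ?scaler0 ?add0r//.
have d := diff_derivable (v := unit_vec axis2) df.
split; first by rewrite /derivable E.
by rewrite /partial /derive E.
Qed.

Lemma MVT_derivable (g dg : R -> R) (s t : R) : s <= t ->
  (forall z : R, is_derive z 1 g (dg z)) ->
  exists2 c, c \in `[s, t] & g t - g s = dg c * (t - s).
Proof.
move=> st dgE; apply: MVT_segment => //.
apply/continuous_subspaceT => z; apply/differentiable_continuous/derivable1_diffP.
exact: (@ex_derive _ _ _ _ _ _ _ (dgE z)).
Qed.

(** The mean value theorem applied first to f (., y + k) - f (., y), then to the
    first partial derivative in the second variable. *)
Lemma mean_value_partial21 f x y h k : smooth f -> 0 <= h -> 0 <= k ->
  exists s t, [/\ s \in `[x, x + h], t \in `[y, y + k] &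
   f (x + h, y + k) - f (x + h, y) - f (x, y + k) + f (x, y) =
   partial axis2 (partial axis1 f) (s, t) * k * h].
Proof.
move=> sf h0 k0.
have df p : differentiable f p by exact: smooth_differentiable.
have d1f p : differentiable (partial axis1 f) p.
  exact/smooth_differentiable/smooth_partial.
have [] := @MVT_derivable (fun z => f (z, y + k) - f (z, y))
    (fun z => partial axis1 f (z, y + k) - partial axis1 f (z, y)) x (x + h).
- by rewrite lerDl.
- by move=> z; apply: is_deriveB; exact: is_derive_section1.
move=> s sxh sE.
have [] := @MVT_derivable (fun z => partial axis1 f (s, z))
    (fun z => partial axis2 (partial axis1 f) (s, z)) y (y + k).
- by rewrite lerDl.
- by move=> z; exact: is_derive_section2.
move=> t tyk tE; exists s, t; split => //.
rewrite (addrC y) addrK (addrC k) in tE; rewrite tE (addrC x) addrK (addrC h) in sE.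
rewrite -sE; ring.
Qed.

(** The same second difference with the two variables taken in the other
    order. *)
Lemma mean_value_partial12 f x y h k : smooth f -> 0 <= h -> 0 <= k ->
  exists s t, [/\ s \in `[x, x + h], t \in `[y, y + k] &
   f (x + h, y + k) - f (x + h, y) - f (x, y + k) + f (x, y) =
   partial axis1 (partial axis2 f) (s, t) * k * h].
Proof.
move=> sf h0 k0.
have df p : differentiable f p by exact: smooth_differentiable.
have d2f p : differentiable (partial axis2 f) p.
  exact/smooth_differentiable/smooth_partial.
have [] := @MVT_derivable (fun z => f (x + h, z) - f (x, z))
    (fun z => partial axis2 f (x + h, z) - partial axis2 f (x, z)) y (y + k).
- by rewrite lerDl.
- by move=> z; apply: is_deriveB; exact: is_derive_section2.
move=> t tyk tE.
have [] := @MVT_derivable (fun z => partial axis2 f (z, t))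
    (fun z => partial axis1 (partial axis2 f) (z, t)) x (x + h).
- by rewrite lerDl.
- by move=> z; exact: is_derive_section1.
move=> s sxh sE; exists s, t; split => //.
rewrite (addrC x) addrK (addrC h) in sE; rewrite sE (addrC y) addrK (addrC k) in tE.
rewrite mulrAC -tE; ring.
Qed.

(** On a small square both mixed derivatives represent the second difference
    divided by the area, at two intermediate points; continuity of the mixed
    derivatives then makes them agree in the limit at the corner. *)
Theorem partial_commute f : smooth f ->
  partial axis2 (partial axis1 f) = partial axis1 (partial axis2 f).
Proof.
move=> sf; apply/funext => -[x y]; apply/eqP; rewrite -subr_eq0 -normr_le0.
apply/ler_addgt0Pl => e e0; rewrite addr0.
have e20 : 0 < e / 2 by rewrite divr_gt0.
have c21 : continuous (partial axis2 (partial axis1 f)).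
  exact/smooth_continuous/smooth_partial/smooth_partial.
have c12 : continuous (partial axis1 (partial axis2 f)).
  exact/smooth_continuous/smooth_partial/smooth_partial.
have /cvgrPdist_lt/(_ _ e20)/nbhs_ballP[d1 /= d10 B1] := c21 (x, y).
have /cvgrPdist_lt/(_ _ e20)/nbhs_ballP[d2 /= d20 B2] := c12 (x, y).
(* Half the smaller radius keeps both intermediate points in both balls. *)
pose h := Num.min d1 d2 / 2.
have m0 : 0 < Num.min d1 d2 by rewrite lt_min d10.
have h0 : 0 < h by rewrite divr_gt0.
have near_box (z w : R) : w \in `[z, z + h] -> ball z (Num.min d1 d2) w.
  rewrite in_itv/= => /andP[zw wzh]; rewrite /ball/= distrC ger0_norm ?subr_ge0//.
  by rewrite /h in wzh h0; lra.
have [s [t [sx ty E21]]] := mean_value_partial21 x y sf (ltW h0) (ltW h0).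
have [s' [t' [sx' ty' E12]]] := mean_value_partial12 x y sf (ltW h0) (ltW h0).
have B1' : ball (x, y) d1 (s, t).
  by split; apply: le_ball (near_box _ _ _); rewrite // ge_min lexx.
have B2' : ball (x, y) d2 (s', t').
  by split; apply: le_ball (near_box _ _ _); rewrite // ge_min lexx orbT.
have := E12; rewrite E21 => /(mulIf (lt0r_neq0 h0))/(mulIf (lt0r_neq0 h0)) E.
have /= h1 := B1 _ B1'; have /= h2 := B2 _ B2'.
have close (u v w : R) : `|u - w| < e / 2 -> `|v - w| < e / 2 -> `|u - v| <= e.
  move=> uw vw; rewrite [e]splitr; apply: le_trans (ler_distD w _ _) _.
  by rewrite lerD ?(ltW uw)// distrC ltW.
by apply: close h1 _; rewrite E.
Qed.

End mixed_partials.

(** * Products of one-variable functions as test functions *)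

Section tensor.
Context {R : realType}.
Implicit Types (P Q : R -> R).

Definition tensor P Q (p : R * R) : R := P p.1 * Q p.2.

Lemma differentiable_tensor P Q p :
  smooth1 P -> smooth1 Q -> differentiable (tensor P Q) p.
Proof.
move=> sP sQ.
have dP : differentiable (P \o fst) p.
  apply: differentiable_comp; last exact/derivable1_diffP/smooth1_derivable.
  by apply: (@linear_differentiable _ _ _ fst) => q; exact: cvg_fst.
have dQ : differentiable (Q \o snd) p.
  apply: differentiable_comp; last exact/derivable1_diffP/smooth1_derivable.
  by apply: (@linear_differentiable _ _ _ snd) => q; exact: cvg_snd.
exact: (differentiableM dP dQ).
Qed.

Lemma partial1_tensor P Q : smooth1 P -> smooth1 Q ->
  partial axis1 (tensor P Q) = tensor (derive1 P) Q.
Proof.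
move=> sP sQ; apply/funext => -[x y].
have /@derive_val <- := is_derive_section1 (differentiable_tensor (x, y) sP sQ).
rewrite /tensor/= derive1E.
have dP : derivable P x 1 by exact: smooth1_derivable.
by rewrite mulrC; exact: (deriveMr (Q y) dP).
Qed.

Lemma partial2_tensor P Q : smooth1 P -> smooth1 Q ->
  partial axis2 (tensor P Q) = tensor P (derive1 Q).
Proof.
move=> sP sQ; apply/funext => -[x y].
have /@derive_val <- := is_derive_section2 (differentiable_tensor (x, y) sP sQ).
rewrite /tensor/= derive1E.
have dQ : derivable Q y 1 by exact: smooth1_derivable.
exact: (deriveMl (P x) dQ).
Qed.

Lemma smooth_tensor P Q : smooth1 P -> smooth1 Q -> smooth (tensor P Q).
Proof.
move=> sP sQ w p.
have [P' [Q' [sP' sQ' ->]]] : exists P' Q',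
    [/\ smooth1 P', smooth1 Q' & partials w (tensor P Q) = tensor P' Q'].
  elim: w => [|i w [P' [Q' [sP' sQ' IH]]]]; first by exists P, Q.
  case: i => /=; rewrite IH.
    by exists (derive1 P'), Q'; split; rewrite ?partial1_tensor//; exact: smooth1_derive.
  by exists P', (derive1 Q'); split; rewrite ?partial2_tensor//; exact: smooth1_derive.
exact: differentiable_tensor.
Qed.

Lemma tensor_test_function P Q (M : R) : smooth1 P -> smooth1 Q ->
  (forall x, M < `|x| -> P x = 0) -> (forall x, M < `|x| -> Q x = 0) ->
  tensor P Q \in @test_function R.
Proof.
move=> sP sQ P0 Q0; apply/test_functionP; split; first exact: smooth_tensor.
pose I : set R := `[- M, M]%classic.
pose K : set (R * R) := I `*` I.
have cK : compact K.
  by apply: compact_setX; exact: segment_compact.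
apply: (subtsupport_compact cK).
have /closure_id -> : closed K.
  by apply: compact_closed => //; exact: norm_hausdorff.
apply: closure_subset => -[x y] /=; rewrite /tensor/= mulf_eq0 negb_or => /andP[Px Qy].
split; rewrite /I/= in_itv/= -ler_norml leNgt; apply/negP.
  by move/P0 => P0x; rewrite P0x eqxx in Px.
by move/Q0 => Q0y; rewrite Q0y eqxx in Qy.
Qed.

End tensor.

(** * Affine changes of variables in integrals over the plane *)

Section affine_change_of_variables.
Context {R : realType}.
Local Notation mu := (@lebesgue_measure R).
Local Notation RR := (measurableTypeR R).

Lemma measurable_affine (s t : R) :
  measurable_fun setT ((fun x => s * x + t) : RR -> RR).
Proof.
apply: measurable_funD => //; exact: measurable_funM.
Qed.

(** Bundles a pushforward as a measure once and for all, so that it can be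
    scaled and compared with others by uniqueness theorems. *)
Lemma pushforward_measureP d1 d2 (T1 : measurableType d1)
    (T2 : measurableType d2) (m : {measure set T1 -> \bar R}) (h : T1 -> T2) :
  measurable_fun setT h ->
  exists2 m' : {measure set T2 -> \bar R},
    forall A, m' A = m (h @^-1` A) &
    forall f : T2 -> \bar R, measurable_fun setT f -> (forall y, 0 <= f y)%E ->
      (\int[m']_y f y = \int[m]_x f (h x))%E.
Proof.
move=> mh; unshelve eexists (pushforward m h) => // f mf f0.
by rewrite ge0_integral_pushforward.
Qed.

(** A measure on the line is determined by its values on half-open intervals,
    and there the identity is a computation of lengths.  For s < 0 the preimage
    is closed on the other side, which does not affect the length. *)
Lemma lebesgue_measure_affine (s t : R) (A : set RR) : s != 0 ->
  measurable A -> (`|s|%:E * mu ((fun x => s * x + t)%R @^-1` A) = mu A)%E.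
Proof.
move=> s0 mA.
have [m mE _] := pushforward_measureP mu (measurable_affine s t).
rewrite -mE -[LHS]/(mscale (NngNum (normr_ge0 s)) m A).
apply/esym/lebesgue_measure_unique => // _ [[a b] _ <-].
rewrite -[RHS]/(`|s|%:E * m _)%E mE/=.
have [s_gt0|s_lt0|/eqP] := ltgtP 0 s; last by rewrite eq_sym (negbTE s0).
- rewrite (_ : _ @^-1` _ = `]((a - t) / s), ((b - t) / s)]%classic); last first.
    apply/seteqP; split => x; rewrite /= !in_itv/= ltr_pdivrMr// ler_pdivlMr//;
      by rewrite ltrBlDr lerBrDr mulrC.
  rewrite !lebesgue_measure_itv/= !lte_fin ltr_pM2r ?invr_gt0// ltrD2r.
  case: ifPn => _; last by rewrite mule0.
  rewrite -!EFinB -EFinM ger0_norm ?(ltW s_gt0)//; congr (_%:E).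
  by field.
- rewrite (_ : _ @^-1` _ = `[((b - t) / s), ((a - t) / s)[%classic); last first.
    apply/seteqP; split => x; rewrite /= !in_itv/= ltr_ndivlMr// ler_ndivrMr//;
      by rewrite ltrBlDr lerBrDr mulrC andbC.
  rewrite !lebesgue_measure_itv/= !lte_fin ltr_nM2r ?invr_lt0// ltrD2r.
  case: ifPn => _; last by rewrite mule0.
  rewrite -!EFinB -EFinM ler0_norm ?(ltW s_lt0)//; congr (_%:E).
  by field.
Qed.

(** The two shapes of an affine bijection that sends axis-parallel rectangles to
    axis-parallel rectangles.  In the second one s1 still goes with the first
    argument, which lands in the second coordinate. *)
Definition axis_affine (s1 t1 s2 t2 : R) (p : RR * RR) : RR * RR :=
  (s1 * p.1 + t1, s2 * p.2 + t2).

Definition swap_affine (s1 t1 s2 t2 : R) (p : RR * RR) : RR * RR :=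
  (s2 * p.2 + t2, s1 * p.1 + t1).

Lemma measurable_axis_affine s1 t1 s2 t2 :
  measurable_fun setT (axis_affine s1 t1 s2 t2).
Proof.
apply: measurable_fun_pair => /=.
  exact: (measurableT_comp (measurable_affine s1 t1) measurable_fst).
exact: (measurableT_comp (measurable_affine s2 t2) measurable_snd).
Qed.

Lemma measurable_swap_affine s1 t1 s2 t2 :
  measurable_fun setT (swap_affine s1 t1 s2 t2).
Proof.
apply: measurable_fun_pair => /=.
  exact: (measurableT_comp (measurable_affine s2 t2) measurable_snd).
exact: (measurableT_comp (measurable_affine s1 t1) measurable_fst).
Qed.

(** The hypothesis on rectangles says that k times the image measure of h agrees
    with the product measure, hence equals it.  The formula for nonnegative
    functions is then applied to the positive and the negative part. *)
Lemma Rintegral_scaled_pushforward (h : RR * RR -> RR * RR) (k : R) (k0 : 0 <= k)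
    (g : R * R -> R) :
  measurable_fun setT h ->
  (forall A B : set RR, measurable A -> measurable B ->
    k%:E * plane_measure (h @^-1` (A `*` B)) = mu A * mu B)%E ->
  plane_measure.-integrable setT (EFin \o g) ->
  plane_measure.-integrable setT (EFin \o (g \o h)) ->
  Rintegral plane_measure setT g = k * Rintegral plane_measure setT (g \o h).
Proof.
move=> mh hE ig igh.
have [m mE mI] := pushforward_measureP plane_measure mh.
have planeE (X : set (RR * RR)) : measurable X ->
    plane_measure X = mscale (NngNum k0) m X.
  move=> mX; apply: product_measure_unique => // A B mA mB.
  by rewrite -[LHS]/(k%:E * m _)%E mE; exact: hE.
have mg : measurable_fun setT (EFin \o g : RR * RR -> \bar R).
  by case/integrableP : ig.
have ge0E (f : RR * RR -> \bar R) : measurable_fun setT f -> (forall p, 0 <= f p)%E ->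
    (\int[plane_measure]_p f p = k%:E * \int[plane_measure]_p f (h p))%E.
  move=> mf f0; rewrite -mI//.
  rewrite -(ge0_integral_mscale m measurableT (NngNum k0) mf (fun p _ => f0 p)).
  by apply: eq_measure_integral => X mX _; exact: planeE.
rewrite /Rintegral.
have -> : (\int[plane_measure]_p (g p)%:E = k%:E * \int[plane_measure]_p (g (h p))%:E)%E.
  rewrite integralE [in RHS]integralE.
  rewrite (ge0E (funepos (EFin \o g)))//; last exact: measurable_funepos.
  rewrite (ge0E (funeneg (EFin \o g)))//; last exact: measurable_funeneg.
  have fp := integrable_pos_fin_num measurableT igh.
  have fn := integrable_neg_fin_num measurableT igh.
  rewrite [RHS]muleBr//; last by apply: fin_num_adde_defl; rewrite fin_numN.
  congr (_ - _)%E; congr (_ * _)%E; apply: eq_integral => p _.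
    by rewrite !funeposE.
  by rewrite !funenegE.
by rewrite fineM//; exact: integrable_fin_num.
Qed.

Lemma Rintegral_axis_affine (s1 t1 s2 t2 : R) (g : R * R -> R) :
  s1 * s2 != 0 ->
  plane_measure.-integrable setT (EFin \o g) ->
  plane_measure.-integrable setT (EFin \o (g \o axis_affine s1 t1 s2 t2)) ->
  Rintegral plane_measure setT g =
    `|s1 * s2| * Rintegral plane_measure setT (g \o axis_affine s1 t1 s2 t2).
Proof.
rewrite mulf_eq0 negb_or => /andP[s10 s20].
apply: Rintegral_scaled_pushforward => // [|A B mA mB].
  exact: measurable_axis_affine.
rewrite (_ : _ @^-1` _ = ((fun x => s1 * x + t1)%R @^-1` A) `*`
  ((fun x => s2 * x + t2)%R @^-1` B)); last by apply/seteqP; split.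
have mpre (s t : R) (C : set RR) :
    measurable C -> measurable ((fun x => s * x + t)%R @^-1` C : set RR).
  by move=> mC; rewrite -[X in measurable X]setTI; exact: measurable_affine.
rewrite [plane_measure _](product_measure1E mu mu (mpre _ _ _ mA) (mpre _ _ _ mB)).
rewrite normrM EFinM -[mu A](lebesgue_measure_affine t1 s10)//.
by rewrite -[mu B](lebesgue_measure_affine t2 s20)// muleACA.
Qed.

Lemma Rintegral_swap_affine (s1 t1 s2 t2 : R) (g : R * R -> R) :
  s1 * s2 != 0 ->
  plane_measure.-integrable setT (EFin \o g) ->
  plane_measure.-integrable setT (EFin \o (g \o swap_affine s1 t1 s2 t2)) ->
  Rintegral plane_measure setT g =
    `|s1 * s2| * Rintegral plane_measure setT (g \o swap_affine s1 t1 s2 t2).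
Proof.
rewrite mulf_eq0 negb_or => /andP[s10 s20].
apply: Rintegral_scaled_pushforward => // [|A B mA mB].
  exact: measurable_swap_affine.
rewrite (_ : _ @^-1` _ = ((fun x => s1 * x + t1)%R @^-1` B) `*`
  ((fun x => s2 * x + t2)%R @^-1` A)); last first.
  by apply/seteqP; split => p [].
have mpre (s t : R) (C : set RR) :
    measurable C -> measurable ((fun x => s * x + t)%R @^-1` C : set RR).
  by move=> mC; rewrite -[X in measurable X]setTI; exact: measurable_affine.
rewrite [plane_measure _](product_measure1E mu mu (mpre _ _ _ mB) (mpre _ _ _ mA)).
rewrite normrM EFinM -[mu A](lebesgue_measure_affine t2 s20)//.
by rewrite -[mu B](lebesgue_measure_affine t1 s10)// muleACA muleC.
Qed.

End affine_change_of_variables.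

(** * Integrals of continuous functions over the plane *)

Section positivity.
Context {R : realType}.

(** By continuity g is at least g p0 / 2 on a square around p0. *)
Lemma Rintegral_plane_gt0 (g : R * R -> R) (p0 : R * R) :
  continuous g -> (forall p, 0 <= g p) ->
  plane_measure.-integrable setT (EFin \o g) -> 0 < g p0 ->
  0 < Rintegral plane_measure setT g.
Proof.
case: p0 => x0 y0 cg g0 ig gp0.
have m0 : 0 < g (x0, y0) / 2 by rewrite divr_gt0.
have /cvgrPdist_lt/(_ _ m0)/nbhs_ballP[e /= e0 eg] := cg (x0, y0).
pose B : set (measurableTypeR R * measurableTypeR R) := ball (x0 : R) e `*` ball (y0 : R) e.
have mball (x : R) : measurable (ball x e : set (measurableTypeR R)).
  by apply: open_measurable; exact: ball_open.
have mB : measurable B by exact: measurableX.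
have muB : plane_measure B = ((e *+ 2) * (e *+ 2))%:E.
  have muI (x : R) : lebesgue_measure (ball x e : set (measurableTypeR R)) = (e *+ 2)%:E.
    exact: lebesgue_measure_ball (ltW e0).
  rewrite EFinM -[X in (X * _)%E](muI x0) -[X in (_ * X)%E](muI y0).
  exact: product_measure1E.
have iB : plane_measure.-integrable setT (EFin \o (fun p => \1_B p : R)).
  apply/integrableP; split; first exact/measurable_EFinP/measurable_indic.
  under eq_integral do rewrite /= ger0_norm//.
  by rewrite integral_indic// setIT muB ltry.
have imB : plane_measure.-integrable setT
    (EFin \o (fun p => g (x0, y0) / 2 * \1_B p : R)).
  have := integrableZl measurableT (g (x0, y0) / 2) iB.
  by apply: eq_integrable => // p _; rewrite /= EFinM.
have : Rintegral plane_measure setT (fun p => g (x0, y0) / 2 * \1_B p : R) <=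
       Rintegral plane_measure setT g.
  apply: le_Rintegral => // -[x y] _; rewrite indicE; case: (boolP (_ \in B)) => [|_].
    rewrite inE mulr1 => Bxy; have /= := eg (x, y) Bxy.
    rewrite ltr_norml => /andP[_]; rewrite ltrBlDr => h; apply/ltW; move: h; lra.
  by rewrite mulr0.
apply: lt_le_trans; rewrite RintegralZl// /Rintegral/= integral_indic// setIT muB/=.
by rewrite !mulr_gt0// mulrn_wgt0.
Qed.

Lemma continuous_lin (F1 F2 : R * R -> R) (k : R) : continuous F1 -> continuous F2 ->
  continuous (fun p => k * F1 p + F2 p).
Proof.
move=> c1 c2 p; apply: cvgD; last exact: c2.
by apply: cvgM; [exact: cvg_cst|exact: c1].
Qed.

Lemma Rintegral_testfun_lin (F1 F2 : R * R -> R) (k : R) (psi : testfun R) :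
  continuous F1 -> continuous F2 ->
  \int[plane_measure]_p ((k * F1 p + F2 p) * psi p) =
  k * \int[plane_measure]_p (F1 p * psi p) + \int[plane_measure]_p (F2 p * psi p).
Proof.
move=> cF1 cF2.
have i1 := regular_integrable cF1 psi; have i2 := regular_integrable cF2 psi.
have ik1 : plane_measure.-integrable setT (EFin \o (fun p => k * (F1 p * psi p))).
  have := integrableZl measurableT k i1.
  by apply: eq_integrable => // p _; rewrite /= EFinM.
rewrite -(RintegralZl _ _ i1)// -RintegralD//.
by apply: eq_Rintegral => p _; rewrite mulrDl mulrA.
Qed.

End positivity.

(** * Functions of a single coordinate have zero mixed derivative *)

Section one_variable_primitives.
Context {R : realType}.

(** The fundamental theorem of calculus on [-M, M], where H vanishes at both
    endpoints. *)
Lemma integral_derive_eq0 (H h : R -> R) (M : R) : 0 < M ->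
  (forall y : R, is_derive y 1 H (h y)) -> continuous h ->
  (forall y, M <= `|y| -> H y = 0) -> (forall y, M <= `|y| -> h y = 0) ->
  (\int[lebesgue_measure]_y (h y)%:E = 0)%E.
Proof.
move=> M0 dH ch H0 h0.
have cH : continuous H.
  by move=> y; apply/differentiable_continuous/derivable1_diffP; case: (dH y).
have -> : (\int[lebesgue_measure]_y (h y)%:E =
           \int[lebesgue_measure]_(y in `[(- M)%R, M]) (h y)%:E)%E.
  rewrite [RHS]integral_mkcond; apply: eq_integral => y _; rewrite patchE.
  case: ifPn => //; rewrite notin_setE/= in_itv/= => /negP.
  by rewrite -ler_norml -ltNge => /ltW/h0 ->.
have MM : - M < M by rewrite gtrN.
rewrite (@continuous_FTC2 _ h H)//.
- by rewrite !H0 ?subee// ?normrN ler_norm.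
- exact/continuous_subspaceT.
- split.
  + by move=> y _; case: (dH y).
  + exact/cvg_at_right_filter/cH.
  + exact/cvg_at_left_filter/cH.
- by move=> y _; rewrite derive1E; case: (dH y).
Qed.

Lemma testfun_box (psi : testfun R) :
  exists2 M : R, 0 < M & forall x y, (M <= `|x|) || (M <= `|y|) -> ~ tsupport psi (x, y).
Proof.
have /compact_bounded/ex_strict_bound_gt0[M M0 KM] := @testfun_compact _ psi.
exists M => // x y out /KM /=; rewrite prod_normE/= gt_max => /andP[xM yM].
by move: out; rewrite leNgt xM leNgt yM.
Qed.

Lemma continuous_section1 (f : R * R -> R) (y : R) : continuous f -> continuous (fun x => f (x, y)).
Proof.
move=> cf x; apply: (@continuous_comp _ _ _ (fun x => (x, y)) f); last exact: cf.
exact: (cvg_pair cvg_id (@cvg_cst _ y _ _ _)).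
Qed.

Lemma continuous_section2 (f : R * R -> R) (x : R) : continuous f -> continuous (fun y => f (x, y)).
Proof.
move=> cf y; apply: (@continuous_comp _ _ _ (fun y => (x, y)) f); last exact: cf.
exact: (cvg_pair (@cvg_cst _ x _ _ _) cvg_id).
Qed.

(** For fixed first coordinate the factor B is constant, so the inner integral
    in Fubini's theorem is that of the derivative of a compactly supported
    function. *)
Lemma Rintegral_partial2_eq0 (B : R -> R) (psi : testfun R) : continuous B ->
  \int[plane_measure]_p (B p.1 * partial axis2 psi p) = 0.
Proof.
move=> cB.
have cB1 : continuous (fun p : R * R => B p.1).
  move=> p; apply: (@continuous_comp _ _ _ fst B); last exact: cB.
  exact: cvg_fst.
have ig := regular_integrable cB1 (testfun_partial axis2 psi).
rewrite /Rintegral -(integral12_prod_meas1 ig) /fubini_F.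
have [M M0 KM] := testfun_box psi.
have inner x :
    (\int[lebesgue_measure]_y (B x * partial axis2 psi (x, y))%R%:E = 0)%E.
  apply: (@integral_derive_eq0 (fun y => B x * psi (x, y)) _ M M0).
  - move=> y; apply: is_deriveZ; apply: is_derive_section2.
    exact: smooth_differentiable (@testfun_smooth _ psi).
  - move=> y; apply: cvgM; first exact: cvg_cst.
    apply: continuous_section2.
    exact/smooth_continuous/smooth_partial/testfun_smooth.
  - by move=> y My; rewrite tsupport_eq0 ?mulr0//; apply: KM; rewrite My orbT.
  - move=> y My /=; rewrite tsupport_eq0 ?mulr0// => /tsupport_partial.
    by apply: KM; rewrite My orbT.
by rewrite integral0_eq// => z _; exact: inner.
Qed.

Lemma Rintegral_partial1_eq0 (B : R -> R) (psi : testfun R) : continuous B ->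
  \int[plane_measure]_p (B p.2 * partial axis1 psi p) = 0.
Proof.
move=> cB.
have cB1 : continuous (fun p : R * R => B p.2).
  move=> p; apply: (@continuous_comp _ _ _ snd B); last exact: cB.
  exact: cvg_snd.
have ig := regular_integrable cB1 (testfun_partial axis1 psi).
rewrite /Rintegral -(integral21_prod_meas1 ig) /fubini_G.
have [M M0 KM] := testfun_box psi.
have inner y :
    (\int[lebesgue_measure]_x (B y * partial axis1 psi (x, y))%R%:E = 0)%E.
  apply: (@integral_derive_eq0 (fun x => B y * psi (x, y)) _ M M0).
  - move=> x; apply: is_deriveZ; apply: is_derive_section1.
    exact: smooth_differentiable (@testfun_smooth _ psi).
  - move=> x; apply: cvgM; first exact: cvg_cst.
    apply: (@continuous_section1 (partial axis1 psi)).
    exact/smooth_continuous/smooth_partial/testfun_smooth.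
  - by move=> x Mx; rewrite tsupport_eq0 ?mulr0//; apply: KM; rewrite Mx.
  - move=> x Mx /=; rewrite tsupport_eq0 ?mulr0// => /tsupport_partial.
    by apply: KM; rewrite Mx.
by rewrite integral0_eq// => z _; exact: inner.
Qed.

End one_variable_primitives.

(** * Rectangle increments are determined by the mixed derivative *)

Section cross_difference.
Context {R : realType}.
Implicit Types (F : R * R -> R) (a b c d : R).

Definition cross_difference F a b c d : R :=
  F (a, c) + F (b, d) - F (a, d) - F (b, c).

Lemma continuous_shift_plane F s t : continuous F ->
  continuous (fun p : R * R => F (p.1 + s, p.2 + t)).
Proof.
move=> cF p.
apply: (@continuous_comp _ _ _ (fun p : R * R => (p.1 + s, p.2 + t)) F); last exact: cF.
rewrite (_ : (fun p : R * R => (p.1 + s, p.2 + t)) = (fun p => p + (s, t))) //.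
exact: (cvgD cvg_id (cvg_cst _)).
Qed.

Lemma Rintegral_translate F (phi psi : testfun R) s t : continuous F ->
  (forall p, psi (p.1 + s, p.2 + t) = phi p) ->
  \int[plane_measure]_p (F p * psi p) =
  \int[plane_measure]_p (F (p.1 + s, p.2 + t) * phi p).
Proof.
move=> cF psiE.
have E : (fun p => F p * psi p) \o axis_affine 1 s 1 t =
         (fun p => F (p.1 + s, p.2 + t) * phi p).
  by apply/funext => p; rewrite /axis_affine/= !mul1r psiE.
have h11 : (1 : R) * 1 != 0 by rewrite mulr1 oner_neq0.
have := Rintegral_axis_affine (t1 := s) (t2 := t) h11 (regular_integrable cF psi).
rewrite E mulr1 normr1 mul1r; apply.
exact: (regular_integrable (@continuous_shift_plane F s t cF) phi).
Qed.

(** Moving each of the four translates of phi back to the origin moves the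
    argument of F instead, and the four values of F combine into one alternating
    sum. *)
Lemma Rintegral_cross_difference F (Phi : R * R -> R) (phi : testfun R)
    (psi : R -> R -> testfun R) a b c d : continuous F ->
  (forall s t p, psi s t (p.1 + s, p.2 + t) = phi p) ->
  (forall p, Phi p = psi a c p + psi b d p - psi a d p - psi b c p) ->
  \int[plane_measure]_p (F p * Phi p) =
  \int[plane_measure]_p
    (cross_difference (fun q => F (p.1 + q.1, p.2 + q.2)) a b c d * phi p).
Proof.
move=> cF psiE PhiE.
(* Nested in this way to match the form c *: u + v of linearity. *)
transitivity (regular_dist cF
    (-1 *: psi a d + (-1 *: psi b c + (1 *: psi a c + psi b d)))).
  apply: eq_Rintegral => p _; rewrite PhiE; congr (_ * _).
  by rewrite !testfun_linE !fctE /GRing.scale/=; ring.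
have L (k : R) (u v : testfun R) :
    regular_dist cF (k *: u + v) = k * regular_dist cF u + regular_dist cF v.
  exact: dist_scalar.
have S s t : regular_dist cF (psi s t) =
    \int[plane_measure]_p (F (p.1 + s, p.2 + t) * phi p).
  exact: Rintegral_translate.
rewrite !L !S.
have cS s t := @continuous_shift_plane F s t cF.
have c1 := @continuous_lin _ _ _ 1 (cS a c) (cS b d).
have c2 := @continuous_lin _ _ _ (-1) (cS b c) c1.
rewrite -(Rintegral_testfun_lin _ _ (cS a c) (cS b d)).
rewrite -(Rintegral_testfun_lin _ _ (cS b c) c1).
rewrite -(Rintegral_testfun_lin _ _ (cS a d) c2).
by apply: eq_Rintegral => p _; rewrite /cross_difference; congr (_ * _); ring.
Qed.

(** For r > 0 this rises from 0 to 1 on the interval [s, s + r]. *)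
Definition step_at (r s : R) (x : R) : R := smooth_step (r^-1 * x + (- (r^-1 * s))).

(** The derivative of [step_at], in closed form so that its sign, its support and
    its translation behaviour can be read off. *)
Definition bump_at (r s : R) (x : R) : R :=
  r^-1 * derive1 smooth_step (r^-1 * x + (- (r^-1 * s))).

Lemma smooth1_step_at r s : smooth1 (step_at r s).
Proof. by move=> n; exact/times_derivable_comp_affine/smooth1_step. Qed.

Lemma derive1_step_at r s : derive1 (step_at r s) = bump_at r s.
Proof.
apply/funext => x; rewrite derive1E.
have dS := smooth1_derivable (@smooth1_step R).
exact: (@derive_val _ _ _ _ _ _ _ (derive1_comp_affine r^-1 (- (r^-1 * s)) x dS)).
Qed.

Lemma smooth1_bump_at r s : smooth1 (bump_at r s).
Proof. by rewrite -derive1_step_at; exact/smooth1_derive/smooth1_step_at. Qed.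

Lemma step_at_le r s x : 0 < r -> x <= s -> step_at r s x = 0.
Proof.
by move=> r0 xs; rewrite /step_at smooth_step_le0// subr_le0 ler_pM2l ?invr_gt0.
Qed.

Lemma step_at_ge r s x : 0 < r -> s + r <= x -> step_at r s x = 1.
Proof.
move=> r0 xs; rewrite /step_at smooth_step_ge1//.
by rewrite -mulrBr ler_pdivlMl// mulr1 lerBrDl.
Qed.

Lemma bump_at_ge0 r s x : 0 < r -> 0 <= bump_at r s x.
Proof. by move=> r0; rewrite /bump_at mulr_ge0 ?derive1_smooth_step_ge0// invr_ge0 ltW. Qed.

Lemma bump_at_eq0 r s x : 0 < r -> (x <= s) || (s + r <= x) -> bump_at r s x = 0.
Proof.
move=> r0 xs; rewrite /bump_at derive1_smooth_step_eq0 ?mulr0//.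
by rewrite subr_le0 ler_pM2l ?invr_gt0// -mulrBr ler_pdivlMl// mulr1 lerBrDl.
Qed.

Lemma bump_at_gt0 r s : 0 < r -> 0 < bump_at r s (s + r / 2).
Proof.
move=> r0; rewrite /bump_at (_ : r^-1 * _ - _ = 2^-1).
  by rewrite mulr_gt0 ?invr_gt0// derive1_smooth_step_gt0.
by field; rewrite lt0r_neq0.
Qed.

Lemma bump_at_shift r s x : bump_at r s (x + s) = bump_at r 0 x.
Proof.
rewrite /bump_at (_ : r^-1 * (x + s) - r^-1 * s = r^-1 * x - r^-1 * 0) //.
ring.
Qed.

Lemma bump_at_far r s M x : 0 < r -> `|s| + r <= M -> M < `|x| -> bump_at r s x = 0.
Proof.
move=> r0 sM xM; apply: bump_at_eq0 => //.
case: (leP x s) => //= sx; rewrite leNgt; apply/negP => xsr.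
move: (le_lt_trans sM xM); apply/negP; rewrite -leNgt.
have s1 := ler_norm s; have s2 := ler_norm (- s); rewrite normrN in s2.
by rewrite ler_norml; apply/andP; split; lra.
Qed.

Lemma step_at_sub_far r s t M x : 0 < r -> `|s| + r <= M -> `|t| + r <= M ->
  M < `|x| -> step_at r s x - step_at r t x = 0.
Proof.
move=> r0 sM tM.
have s1 := ler_norm s; have s2 := ler_norm (- s); rewrite normrN in s2.
have t1 := ler_norm t; have t2 := ler_norm (- t); rewrite normrN in t2.
have [x0|x0] := leP 0 x.
  by rewrite ger0_norm// => xM; rewrite !step_at_ge ?subrr//; lra.
by rewrite ltr0_norm// => xM; rewrite !step_at_le ?subrr//; lra.
Qed.

Lemma bump_test_in r s t : 0 < r ->
  tensor (bump_at r s) (bump_at r t) \in @test_function R.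
Proof.
move=> r0; have s0 := normr_ge0 s; have t0 := normr_ge0 t.
apply: (@tensor_test_function _ _ _ (`|s| + `|t| + r)) => [||x|x];
  try exact: smooth1_bump_at.
  by apply: bump_at_far => //; lra.
by apply: bump_at_far => //; lra.
Qed.

Definition step_diff r s t (x : R) : R := step_at r s x - step_at r t x.

Lemma smooth1_step_diff r s t : smooth1 (step_diff r s t).
Proof.
move=> n; rewrite (_ : step_diff r s t = step_at r s \+ (fun x => - 1 * step_at r t x)).
  by apply: times_derivableD; [|apply: times_derivableZ]; exact: smooth1_step_at.
by apply/funext => x; rewrite /step_diff /= mulN1r.
Qed.

Lemma derive1_step_diff r s t x :
  derive1 (step_diff r s t) x = bump_at r s x - bump_at r t x.
Proof.
have ds u : derivable (step_at r u) x 1 by exact/smooth1_derivable/smooth1_step_at.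
by rewrite derive1E deriveB// -!derive1E !derive1_step_at.
Qed.

Lemma step_diff_test_in r a b c d : 0 < r ->
  tensor (step_diff r a b) (step_diff r c d) \in @test_function R.
Proof.
move=> r0; have a0 := normr_ge0 a; have b0 := normr_ge0 b.
have c0 := normr_ge0 c; have d0 := normr_ge0 d.
apply: (@tensor_test_function _ _ _ (`|a| + `|b| + `|c| + `|d| + r)) => [||x|x];
  try exact: smooth1_step_diff.
  by apply: step_at_sub_far => //; lra.
by apply: step_at_sub_far => //; lra.
Qed.

Lemma mixed_partial_step_diff r a b c d p :
  partial axis2 (partial axis1 (tensor (step_diff r a b) (step_diff r c d))) p =
  (bump_at r a p.1 - bump_at r b p.1) * (bump_at r c p.2 - bump_at r d p.2).
Proof.
have sS s t := @smooth1_step_diff r s t.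
rewrite partial1_tensor// partial2_tensor//; last exact: smooth1_derive.
by rewrite /tensor/= !derive1_step_diff.
Qed.

(** It suffices to exclude a positive value, replacing F by its opposite for the
    negative ones.  If the alternating sum is positive it stays so when the
    rectangle is moved by less than e in each direction; integrating it against a
    bump of width e / 2 gives a positive number, which is however the pairing of
    F with a mixed derivative, hence zero. *)
Theorem cross_difference_eq0 F a b c d : continuous F ->
  (forall phi : testfun R,
    \int[plane_measure]_p (F p * partial axis2 (partial axis1 phi) p) = 0) ->
  cross_difference F a b c d = 0.
Proof.
suff cross_le0 (G : R * R -> R) : continuous G ->
    (forall phi : testfun R,
      \int[plane_measure]_p (G p * partial axis2 (partial axis1 phi) p) = 0) ->
    cross_difference G a b c d <= 0.
  move=> cF F0; apply/eqP; rewrite eq_le cross_le0//=.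
  have cNF : continuous (fun p : R * R => - F p) by move=> p; apply: cvgN; exact: cF.
  have : cross_difference (fun p => - F p) a b c d <= 0.
    apply: cross_le0 => // phi.
    have c0 : continuous (fun _ : R * R => 0 : R) by move=> p; exact: cvg_cst.
    have /= := Rintegral_testfun_lin (-1) (testfun_partial axis2 (testfun_partial axis1 phi)) cF c0.
    rewrite F0 mulr0 add0r => E.
    transitivity (\int[plane_measure]_p
        ((- 1 * F p + 0) * partial axis2 (partial axis1 phi) p)).
      by apply: eq_Rintegral => p _; rewrite mulN1r addr0.
    rewrite E; under eq_Rintegral do rewrite mul0r.
    by rewrite /Rintegral integral0.
  by rewrite /cross_difference; lra.
move=> cG G0; rewrite leNgt; apply/negP => D0.
pose D (p : R * R) := cross_difference (fun q => G (p.1 + q.1, p.2 + q.2)) a b c d.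
have cS s t := @continuous_shift_plane G s t cG.
have cD : continuous D.
  by move=> p; apply: cvgB; [apply: cvgB; [apply: cvgD|]|]; exact: cS.
have D00 : 0 < D (0, 0) by rewrite /D/= /cross_difference !add0r.
have /cvgrPdist_lt/(_ _ D00)/nbhs_ballP[e /= e0 eD] := cD (0, 0).
have Dpos p : ball ((0, 0) : R * R) e p -> 0 < D p.
  by move/eD; rewrite /= ltr_norml => /andP[_]; rewrite ltrBlDr ltrDl.
(* The bump has support in [0, r] in each coordinate, inside the ball of
   radius e on which D is positive. *)
pose r := e / 2; have r0 : 0 < r by rewrite divr_gt0.
pose rho := tensor (bump_at r 0) (bump_at r 0).
have I0 : \int[plane_measure]_p (D p * rho p) = 0.
  rewrite -(G0 (TestFun (step_diff_test_in a b c d r0))); apply/esym.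
  apply: (Rintegral_cross_difference (phi := TestFun (bump_test_in 0 0 r0))
    (psi := fun s t => TestFun (bump_test_in s t r0)) cG) => [s t p|p].
    by rewrite /= /tensor !bump_at_shift.
  have expand (u1 u2 v1 v2 : R) :
    (u1 - u2) * (v1 - v2) = u1 * v1 + u2 * v2 - u1 * v2 - u2 * v1 by ring.
  rewrite mixed_partial_step_diff; exact: expand.
have : 0 < \int[plane_measure]_p (D p * rho p).
  apply: (@Rintegral_plane_gt0 _ (fun p => D p * rho p) (r / 2, r / 2)).
  - move=> p; apply: cvgM; first exact: cD.
    by apply/smooth_continuous/smooth_tensor; exact: smooth1_bump_at.
  - move=> [x y]; have [xr|xr] := boolP ((0 < x < r) && (0 < y < r)).
      apply: mulr_ge0; last by rewrite mulr_ge0 ?bump_at_ge0.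
      case/andP: xr => /andP[x0 xr] /andP[y0 yr]; apply/ltW/Dpos.
      by split; rewrite /ball/= sub0r normrN gtr0_norm//; rewrite /r in r0 xr yr; lra.
    suff -> : rho (x, y) = 0 by rewrite mulr0.
    rewrite /rho /tensor/=.
    move: xr; rewrite negb_and !negb_and -!leNgt => /orP[xr|yr].
      by rewrite (bump_at_eq0 (x := x)) ?mul0r// add0r.
    by rewrite (bump_at_eq0 (x := y)) ?mulr0// add0r.
  - exact: (regular_integrable cD (TestFun (bump_test_in 0 0 r0))).
  - have h : 0 < bump_at r 0 (r / 2) by have := bump_at_gt0 0 r0; rewrite add0r.
    apply: mulr_gt0; last by rewrite mulr_gt0.
    apply: Dpos.
    by split; rewrite /ball/= sub0r normrN gtr0_norm ?divr_gt0//; rewrite /r in r0 *; lra.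
by rewrite I0 ltxx.
Qed.

End cross_difference.

(** * Primitives of the pulled-back distribution *)

Section mixed_derivative_distribution.
Context {R : realType}.

Definition eaffine (s t : R) (x : \bar R) : \bar R := (s%:E * x + t%:E)%E.

(** Addition of extended reals is continuous here because t is finite, so no
    sum of opposite infinities can occur. *)
Lemma eaffine_continuous s t : continuous (eaffine s t).
Proof.
move=> x; apply: cvgeD; last exact: cvg_cst.
  exact: fin_num_adde_defl.
exact: cvgeZl.
Qed.

Lemma eaffine_fin s t (x : R) : eaffine s t x%:E = (s * x + t)%:E.
Proof. by rewrite /eaffine -EFinM -EFinD. Qed.

Lemma continuous_pair_comp (F : \bar R * \bar R -> R) (g1 g2 : \bar R * \bar R -> \bar R) :
  continuous F -> continuous g1 -> continuous g2 -> continuous (fun p => F (g1 p, g2 p)).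
Proof.
move=> cF c1 c2 p.
apply: (@continuous_comp _ _ _ (fun p => (g1 p, g2 p)) F); last exact: cF.
exact: (cvg_pair (c1 p) (c2 p)).
Qed.

(** Subtracts the values on the two lines at -oo; the last term restores what is
    subtracted twice at their intersection. *)
Definition normalized (F : \bar R * \bar R -> R) (p : \bar R * \bar R) : R :=
  F p - F (-oo%E, p.2) - F (p.1, -oo%E) + F (-oo%E, -oo%E).

Lemma normalized_Bc F : continuous F -> Bc (normalized F).
Proof.
move=> cF; split; last by move=> s; rewrite /normalized/=; split; ring.
have cfst : continuous (fst : \bar R * \bar R -> \bar R) by move=> p; exact: cvg_fst.
have csnd : continuous (snd : \bar R * \bar R -> \bar R) by move=> p; exact: cvg_snd.
have ccst : continuous (fun _ : \bar R * \bar R => -oo%E : \bar R) by move=> p; exact: cvg_cst.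
have c1 := continuous_pair_comp cF ccst csnd.
have c2 := continuous_pair_comp cF cfst ccst.
move=> p; apply: cvgD; last exact: cvg_cst.
by apply: cvgB; [apply: cvgB; [exact: cF|exact: c1]|exact: c2].
Qed.

Lemma dist_partial12E (F : \bar R * \bar R -> R) (cF : continuous F) (phi : testfun R) :
  dist_partial12 cF phi =
  \int[plane_measure]_p (plane_restr F p * partial axis2 (partial axis1 phi) p).
Proof. exact: opprK. Qed.

(** The three correction terms depend on at most one coordinate.  The one in the
    second coordinate is paired with the mixed derivative taken in the other
    order, so that the derivative in the first coordinate comes last. *)
Lemma dist_partial12_normalized F (cF : continuous F) :
  dist_partial12 (normalized_Bc cF).1 = dist_partial12 cF.
Proof.
apply: distribution_eq => phi; rewrite !dist_partial12E.
have cfst : continuous (fst : \bar R * \bar R -> \bar R) by move=> p; exact: cvg_fst.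
have csnd : continuous (snd : \bar R * \bar R -> \bar R) by move=> p; exact: cvg_snd.
have ccst : continuous (fun _ : \bar R * \bar R => -oo%E : \bar R) by move=> p; exact: cvg_cst.
have cA := plane_restr_continuous (continuous_pair_comp cF ccst csnd).
have cB := plane_restr_continuous (continuous_pair_comp cF cfst ccst).
have cR := plane_restr_continuous cF.
have c0 : continuous (fun _ : R * R => F (-oo%E, -oo%E)) by move=> p; exact: cvg_cst.
pose psi := testfun_partial axis2 (testfun_partial axis1 phi).
have c1 := @continuous_lin _ _ _ 1 cR c0.
have c2 := @continuous_lin _ _ _ (-1) cB c1.
have A0 : \int[plane_measure]_p (plane_restr (fun q => F (-oo%E, q.2)) p * psi p) = 0.
  rewrite /psi/= (partial_commute (@testfun_smooth _ phi)).
  exact: (Rintegral_partial1_eq0 (testfun_partial axis2 phi)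
    (continuous_section2 (x := 0) cA)).
have B0 : \int[plane_measure]_p (plane_restr (fun q => F (q.1, -oo%E)) p * psi p) = 0.
  exact: (Rintegral_partial2_eq0 (testfun_partial axis1 phi)
    (continuous_section1 (y := 0) cB)).
have C0 : \int[plane_measure]_p (F (-oo%E, -oo%E) * psi p) = 0.
  apply: (@Rintegral_partial2_eq0 _ (fun _ => F (-oo%E, -oo%E)) (testfun_partial axis1 phi)).
  by move=> x; exact: cvg_cst.
transitivity (\int[plane_measure]_p
    ((-1 * plane_restr (fun q => F (-oo%E, q.2)) p +
      (-1 * plane_restr (fun q => F (q.1, -oo%E)) p +
       (1 * plane_restr F p + F (-oo%E, -oo%E)))) * psi p)).
  apply: eq_Rintegral => p _; congr (_ * _).
  by rewrite /plane_restr /normalized/=; ring.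
rewrite (Rintegral_testfun_lin _ _ cA c2) (Rintegral_testfun_lin _ _ cB c1).
rewrite (Rintegral_testfun_lin _ _ cR c0).
by rewrite A0 B0 C0 !mulr0 !add0r addr0 mul1r.
Qed.

(** The factor k from the chain rule cancels the factor k^-1 in H, and the
    Jacobian `|k| from the substitution cancels the one in the definition of the
    composition with Psi. *)
Lemma dist_comp_partial12 (Psi : affine_bij R) (k : R) (F H : \bar R * \bar R -> R)
    (cF : continuous F) (cH : continuous H) :
  k != 0 -> `|aff_det Psi| = `|k| ->
  (forall p, plane_restr H p = k^-1 * plane_restr F (Psi p)) ->
  (forall chi : testfun R, partial axis2 (partial axis1 (chi \o Psi)) =
    k *: (partial axis2 (partial axis1 chi) \o Psi)) ->
  (forall g : R * R -> R, plane_measure.-integrable setT (EFin \o g) ->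
    plane_measure.-integrable setT (EFin \o (g \o Psi)) ->
    Rintegral plane_measure setT g = `|k| * Rintegral plane_measure setT (g \o Psi)) ->
  dist_comp (dist_partial12 cF) Psi = dist_partial12 cH.
Proof.
move=> k0 detk HF chain subst_int; apply: distribution_eq => phi.
rewrite dist_partial12E -[LHS]/(dist_comp_fun _ Psi phi) /dist_comp_fun.
rewrite dist_partial12E detk.
pose chi := testfun_comp phi (aff_inv Psi); rewrite -/chi.
have chiPsi : (phi : R * R -> R) = chi \o Psi.
  by apply/funext => p; rewrite /= aff_K.
have cR := plane_restr_continuous cF.
have cRPsi : continuous (fun p => plane_restr F (Psi p)).
  move=> p; apply: (@continuous_comp _ _ _ Psi (plane_restr F)); last exact: cR.
  exact: aff_continuous.
pose psi := testfun_partial axis2 (testfun_partial axis1 chi).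
pose g (p : R * R) := plane_restr F p * psi p.
have gE : \int[plane_measure]_p g p = `|k| * \int[plane_measure]_p (g \o Psi) p.
  apply: subst_int; first exact: (regular_integrable cR psi).
  exact: (regular_integrable cRPsi (testfun_comp psi Psi)).
have cancel_k (x y : R) : x = `|k| * y -> `|k|^-1 * x = y.
  by move=> ->; rewrite mulKf ?normr_eq0.
transitivity (\int[plane_measure]_p (g \o Psi) p); first exact: cancel_k gE.
apply: eq_Rintegral => p _.
rewrite chiPsi chain HF -[LHS]/(plane_restr F (Psi p) * psi (Psi p)).
rewrite -[(k *: _) p]/(k * psi (Psi p)).
by move: (plane_restr F _) (psi _) => u v; field.
Qed.

(** Two primitives differ by a function of zero mixed derivative, whose
    alternating sums vanish. *)
Lemma integral_of_primitive (f : plane_distribution R) (G : \bar R * \bar R -> R)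
    (a b c d : R) : primitives f G ->
  cp_integral f a%:E b%:E c%:E d%:E = cross_difference (plane_restr G) a b c d.
Proof.
move=> fG; have : primitives f (primitive f) by exact: xgetPex (ex_intro _ G fG).
rewrite /cp_integral; set F := primitive f => -[BF fF]; case: fG => BG fGE.
have cF := plane_restr_continuous BF.1; have cG := plane_restr_continuous BG.1.
have cGF := @continuous_lin _ _ _ (-1) cG cF.
have : cross_difference (fun p => -1 * plane_restr G p + plane_restr F p) a b c d = 0.
  apply: cross_difference_eq0 => // phi.
  rewrite (Rintegral_testfun_lin (-1) (testfun_partial axis2 (testfun_partial axis1 phi)) cG cF).
  by rewrite -(dist_partial12E BG.1) -(dist_partial12E BF.1) -fGE -fF mulN1r addNr.
rewrite /cross_difference /plane_restr/= => E.
by apply/eqP; rewrite -subr_eq0 -E; apply/eqP; ring.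
Qed.

End mixed_derivative_distribution.

Section main.
Context {R : realType}.
Implicit Types (Psi : affine_bij R) (alpha beta : R).

Lemma aff_detE Psi : aff_det Psi =
  aff_mx Psi 0 0 * aff_mx Psi 1 1 - aff_mx Psi 0 1 * aff_mx Psi 1 0.
Proof.
rewrite /aff_det (expand_det_row _ 0) !big_ord_recl big_ord0 addr0.
rewrite /cofactor !det_mx11 !mxE /= expr0 expr1 mul1r mulN1r mulrN.
by congr (_ * aff_mx Psi _ _ - aff_mx Psi _ _ * aff_mx Psi _ _); exact/val_inj.
Qed.

Lemma partialZ i k (f : R * R -> R) : smooth f -> partial i (k *: f) = k *: partial i f.
Proof.
move=> sf; apply/funext => p; rewrite /partial deriveZ//.
exact/diff_derivable/smooth_differentiable.
Qed.

Lemma mixed_partial_comp_axis Psi alpha beta (chi : R * R -> R) : smooth chi ->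
  aff_mx Psi 0 0 = alpha -> aff_mx Psi 0 1 = 0 ->
  aff_mx Psi 1 0 = 0 -> aff_mx Psi 1 1 = beta ->
  partial axis2 (partial axis1 (chi \o Psi)) =
  (alpha * beta) *: (partial axis2 (partial axis1 chi) \o Psi).
Proof.
move=> schi m00 m01 m10 m11.
have s1 : smooth (partial axis1 chi) by exact: smooth_partial.
rewrite partial_comp_aff//= m00 m10 scale0r addr0.
rewrite partialZ; last exact: smooth_comp_aff.
by rewrite partial_comp_aff//= m01 m11 scale0r add0r scalerA.
Qed.

Lemma mixed_partial_comp_swap Psi alpha beta (chi : R * R -> R) : smooth chi ->
  aff_mx Psi 0 0 = 0 -> aff_mx Psi 0 1 = beta ->
  aff_mx Psi 1 0 = alpha -> aff_mx Psi 1 1 = 0 ->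
  partial axis2 (partial axis1 (chi \o Psi)) =
  (alpha * beta) *: (partial axis2 (partial axis1 chi) \o Psi).
Proof.
move=> schi m00 m01 m10 m11.
have s2 : smooth (partial axis2 chi) by exact: smooth_partial.
rewrite partial_comp_aff//= m00 m10 scale0r add0r.
rewrite partialZ; last exact: smooth_comp_aff.
by rewrite partial_comp_aff//= m01 m11 scale0r addr0 scalerA partial_commute.
Qed.

(** Both parts of the theorem at once: what distinguishes them is only how the
    mixed derivative and the integral transform under Psi, which is assumed
    here.  The function H is the candidate primitive before normalization. *)
Lemma integral_dist_comp Psi (k : R) (f : plane_distribution R)
    (F H : \bar R * \bar R -> R) (a b c d : R) :
  primitives f F -> continuous H -> k != 0 -> `|aff_det Psi| = `|k| ->
  (forall p, plane_restr H p = k^-1 * plane_restr F (Psi p)) ->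
  (forall chi : testfun R, partial axis2 (partial axis1 (chi \o Psi)) =
    k *: (partial axis2 (partial axis1 chi) \o Psi)) ->
  (forall g : R * R -> R, plane_measure.-integrable setT (EFin \o g) ->
    plane_measure.-integrable setT (EFin \o (g \o Psi)) ->
    Rintegral plane_measure setT g = `|k| * Rintegral plane_measure setT (g \o Psi)) ->
  Ac (dist_comp f Psi) /\
  k * cp_integral (dist_comp f Psi) a%:E b%:E c%:E d%:E =
    plane_restr F (Psi (a, c)) + plane_restr F (Psi (b, d)) -
    plane_restr F (Psi (a, d)) - plane_restr F (Psi (b, c)).
Proof.
move=> [BF fF] cH k0 detk HF chain subst_int.
have prim : primitives (dist_comp f Psi) (normalized H).
  exists (normalized_Bc cH); rewrite dist_partial12_normalized fF.
  exact: dist_comp_partial12 HF chain subst_int.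
split; first by exists (normalized H).
rewrite (integral_of_primitive _ _ _ _ prim).
transitivity (k * cross_difference (plane_restr H) a b c d).
  by rewrite /cross_difference /plane_restr /normalized/=; ring.
by rewrite /cross_difference !HF; field.
Qed.

End main.

Theorem theorem10p2 (R : realType) (alpha beta gamma1 gamma2 : R)
    (alpha_beta_neq0 : alpha * beta != 0)
    (a b c d : R) (le_ab : a <= b) (le_cd : c <= d)
    (f : plane_distribution R) (Ac_f : Ac f) :
  (forall Psi : affine_bij R,
    (forall u v : R, Psi (u, v) = (alpha * u + gamma1, beta * v + gamma2)) ->
    Ac (dist_comp f Psi) /\
    cp_integral f a%:E b%:E c%:E d%:E =
      alpha * beta *
      cp_integral (dist_comp f Psi)
        ((a - gamma1) / alpha)%:E ((b - gamma1) / alpha)%:E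
        ((c - gamma2) / beta)%:E ((d - gamma2) / beta)%:E) /\
  (forall Psi : affine_bij R,
    (forall u v : R, Psi (u, v) = (beta * v + gamma2, alpha * u + gamma1)) ->
    Ac (dist_comp f Psi) /\
    cp_integral f a%:E b%:E c%:E d%:E =
      alpha * beta *
      cp_integral (dist_comp f Psi)
        ((c - gamma1) / alpha)%:E ((d - gamma1) / alpha)%:E
        ((a - gamma2) / beta)%:E ((b - gamma2) / beta)%:E).
Proof.
have [alpha0 beta0] : alpha != 0 /\ beta != 0.
  by move: (alpha_beta_neq0); rewrite mulf_eq0 negb_or => /andP.
have [F fF] := Ac_f; have [[cF _] _] := fF.
have cfst : continuous (fst : \bar R * \bar R -> \bar R) by move=> p; exact: cvg_fst.
have csnd : continuous (snd : \bar R * \bar R -> \bar R) by move=> p; exact: cvg_snd.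
have ce (s t : R) (h : \bar R * \bar R -> \bar R) : continuous h -> continuous (eaffine s t \o h).
  by move=> ch p; apply: continuous_comp; [exact: ch|exact: eaffine_continuous].
have cZ (g : \bar R * \bar R -> R) : continuous g ->
    continuous (fun p => (alpha * beta)^-1 * g p).
  by move=> cg p; apply: cvgM; [exact: cvg_cst|exact: cg].
have back1 x : alpha * ((x - gamma1) / alpha) + gamma1 = x by field.
have back2 y : beta * ((y - gamma2) / beta) + gamma2 = y by field.
rewrite (integral_of_primitive _ _ _ _ fF); split=> Psi PsiE.
- have [e1 e2] := PsiE 0 0; have [e3 e4] := PsiE 1 0; have [e5 e6] := PsiE 0 1.
  rewrite /= in e1 e2 e3 e4 e5 e6.
  have m00 : aff_mx Psi 0 0 = alpha by lra.
  have m01 : aff_mx Psi 0 1 = 0 by lra.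
  have m10 : aff_mx Psi 1 0 = 0 by lra.
  have m11 : aff_mx Psi 1 1 = beta by lra.
  have cH := cZ _ (continuous_pair_comp cF (ce alpha gamma1 _ cfst) (ce beta gamma2 _ csnd)).
  have PsiE' : (Psi : R * R -> R * R) = axis_affine alpha gamma1 beta gamma2.
    by apply/funext => -[u v]; rewrite PsiE.
  have [] := @integral_dist_comp R Psi (alpha * beta) f F _
    ((a - gamma1) / alpha) ((b - gamma1) / alpha)
    ((c - gamma2) / beta) ((d - gamma2) / beta) fF cH alpha_beta_neq0.
  + by rewrite aff_detE m00 m01 m11 mul0r subr0.
  + by move=> [u v]; rewrite PsiE /plane_restr/= !eaffine_fin.
  + by move=> chi; apply: mixed_partial_comp_axis => //; exact: testfun_smooth.
  + by rewrite PsiE' => g; exact: Rintegral_axis_affine.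
  by move=> AcPsi ->; split => //; rewrite !PsiE !back1 !back2.
- have [e1 e2] := PsiE 0 0; have [e3 e4] := PsiE 1 0; have [e5 e6] := PsiE 0 1.
  rewrite /= in e1 e2 e3 e4 e5 e6.
  have m00 : aff_mx Psi 0 0 = 0 by lra.
  have m01 : aff_mx Psi 0 1 = beta by lra.
  have m10 : aff_mx Psi 1 0 = alpha by lra.
  have m11 : aff_mx Psi 1 1 = 0 by lra.
  have cH := cZ _ (continuous_pair_comp cF (ce beta gamma2 _ csnd) (ce alpha gamma1 _ cfst)).
  have PsiE' : (Psi : R * R -> R * R) = swap_affine alpha gamma1 beta gamma2.
    by apply/funext => -[u v]; rewrite PsiE.
  have [] := @integral_dist_comp R Psi (alpha * beta) f F _
    ((c - gamma1) / alpha) ((d - gamma1) / alpha)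
    ((a - gamma2) / beta) ((b - gamma2) / beta) fF cH alpha_beta_neq0.
  + by rewrite aff_detE m00 m01 m10 mul0r sub0r normrN mulrC.
  + by move=> [u v]; rewrite PsiE /plane_restr/= !eaffine_fin.
  + by move=> chi; apply: mixed_partial_comp_swap => //; exact: testfun_smooth.
  + by rewrite PsiE' => g; exact: Rintegral_swap_affine.
  move=> AcPsi ->; split => //; rewrite !PsiE !back1 !back2.
  by rewrite /cross_difference addrAC.
Qed.
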